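(* Let $k$ be a subfield of $\mathbf{C}$, let $A$ be a locally finite graded set with an operation $[\cdot,\cdot]$ on $\bar A=A\cup\{0\}$ satisfying (S0)–(S3), let $*$ be the associated quasi-shuffle product and $ш$ the shuffle product on $\mathfrak{A}=k\langle A\rangle$. Then $\exp:\mathfrak{A}\to\mathfrak{A}$ is a Hopf algebra isomorphism of $(\mathfrak{A},ш,\Delta)$ onto $(\mathfrak{A},*,\Delta)$.
   Context: $A$ is a graded set, $A=\bigsqcup_{n\ge1}A_n$ with each $A_n$ (the elements of degree $n$) finite; elements of $A$ are called letters and $|a|$ is the degree of a letter $a$. $\mathfrak{A}=k\langle A\rangle$ is the $k$-vector space of noncommutative polynomials in the letters, with basis the words (monomials) in the letters, including the empty word $1$. Juxtaposition denotes concatenation. $\ell(w)$ is the number of letters of a word $w$; its degree is the sum of the degrees of its letters, and $\mathfrak{A}$ is graded by degree. Let $\bar A=A\cup\{0\}$ and let $[\cdot,\cdot]:\bar A\times\bar A\to\bar A$ be a function satisfying: (S0) $[a,0]=0$ for all $a\in\bar A$; (S1) $[a,b]=[b,a]$ for all $a,b\in\bar A$; (S2) $[[a,b],c]=[a,[b,c]]$ for all $a,b,c\in\bar A$; (S3) for all $a,b\in A$, either $[a,b]=0$ or $|[a,b]|=|a|+|b|$. The quasi-shuffle product $*$ is the $k$-bilinear operation on $\mathfrak{A}$ defined recursively on words by $1*w=w*1=w$ and $aw_1*bw_2=a(w_1*bw_2)+b(aw_1*w_2)+[a,b](w_1*w_2)$ for letters $a,b$ and words $w_1,w_2$. The shuffle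 product $ш$ is defined by the same recursion with the last term omitted. The comultiplication $\Delta:\mathfrak{A}\to\mathfrak{A}\otimes\mathfrak{A}$ and counit $\epsilon:\mathfrak{A}\to k$ are the linear maps given on words by $\Delta(w)=\sum_{uv=w}u\otimes v$ (sum over all factorizations of $w$ as a concatenation of possibly empty words), $\epsilon(1)=1$, and $\epsilon(w)=0$ for $w\ne1$. With these, $(\mathfrak{A},ш,\Delta)$ and $(\mathfrak{A},*,\Delta)$ are Hopf algebras. For a nonempty finite sequence of letters define $[a]=a$ and $[a_1,a_2,\dots,a_m]=[a_1,[a_2,\dots,a_m]]\in\bar A$. A composition of $n\ge1$ is a sequence $I=(i_1,\dots,i_l)$ of positive integers with sum $n$; $\mathcal{C}(n)$ is the set of compositions of $n$. For a word $w=a_1\cdots a_n$ and $I=(i_1,\dots,i_l)\in\mathcal{C}(n)$, set $I[w]=[a_1,\dots,a_{i_1}][a_{i_1+1},\dots,a_{i_1+i_2}]\cdots[a_{i_1+\dots+i_{l-1}+1},\dots,a_n]\in\mathfrak{A}$ (which is $0$ if any bracket is $0$). The linear map $\exp:\mathfrak{A}\to\mathfrak{A}$ is defined by $\exp(1)=1$ and $\exp(w)=\sum_{(i_1,\dots,i_l)\in\mathcal{C}(\ell(w))}\frac{1}{i_1!\cdots i_l!}(i_1,\dots,i_l)[w]$ for nonempty words $w$. *)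

(* Defs.v *)
From HB Require Import structures.
From mathcomp Require Import all_boot all_order all_algebra.
From mathcomp Require Import finmap monalg.
From mathcomp Require Import boolp classical_sets cardinality reals.
From mathcomp Require Import complex.

Set Implicit Arguments.
Unset Strict Implicit.
Unset Printing Implicit Defensive.

Import GRing.Theory.
Local Open Scope ring_scope.

(* The k-module with basis K is {malg k[K]}; the basis element u is << u >>.  *)
(* As {malg k[K]} is free on K, its tensor product with {malg k[L]} is taken  *)
(* to be {malg k[K * L]}, with << u >> (x) << v >> := << (u, v) >>; that this *)
(* is a tensor product is tens_linear_l, tens_linear_r, tens_liftE and        *)
(* tens_lift_uniq below.                                                      *)
Section FreeModule.
Context {k : fieldType}.

Definition lin_ext (K : choiceType) (M : lmodType k) (f : K -> M)
    (x : {malg k[K]}) : M :=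
  \sum_(u <- msupp x) x@_u *: f u.

Definition tens (K L : choiceType) (x : {malg k[K]}) (y : {malg k[L]}) :
    {malg k[(K * L)%type]} :=
  lin_ext (fun u => lin_ext (fun v => << (u, v) >>) y) x.

Definition tens_lift (K L : choiceType) (M : lmodType k)
    (B : {malg k[K]} -> {malg k[L]} -> M) : {malg k[(K * L)%type]} -> M :=
  lin_ext (fun p => B << p.1 >> << p.2 >>).

Definition tens_map (K L K' L' : choiceType)
    (f : {malg k[K]} -> {malg k[K']}) (g : {malg k[L]} -> {malg k[L']}) :
    {malg k[(K * L)%type]} -> {malg k[(K' * L')%type]} :=
  tens_lift (fun x y => tens (f x) (g y)).

Definition tens_assoc (K L M : choiceType) :
    {malg k[(K * L * M)%type]} -> {malg k[(K * (L * M))%type]} :=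
  lin_ext (fun p => << (p.1.1, (p.1.2, p.2)) >>).

Lemma lin_extEw (K : choiceType) (M : lmodType k) (f : K -> M) x
    (D : {fset K}) : (msupp x `<=` D)%fset ->
  lin_ext f x = \sum_(u <- D) x@_u *: f u.
Proof.
move=> sxD; apply: big_fset_incl => // u _ ux.
by rewrite mcoeff_outdom // scale0r.
Qed.

Lemma lin_ext_linear (K : choiceType) (M : lmodType k) (f : K -> M) :
  linear (lin_ext f).
Proof.
move=> c x y.
pose D := (msupp x `|` msupp y `|` msupp (c *: x + y))%fset.
rewrite !(@lin_extEw _ _ f _ D) /D; last 3 first.
- by apply: fsubsetU; rewrite fsubsetUr.
- by apply: fsubsetU; rewrite fsubsetUl.
- by rewrite fsubsetUr.
rewrite scaler_sumr -big_split /=; apply: eq_bigr => u _.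
by rewrite mcoeffD mcoeffZ scalerDl scalerA.
Qed.

Lemma lin_extU (K : choiceType) (M : lmodType k) (f : K -> M) u :
  lin_ext f << u >> = f u.
Proof.
rewrite (@lin_extEw _ _ f _ [fset u]%fset) ?msuppU_le //.
by rewrite big_seq_fset1 mcoeffUU scale1r.
Qed.

Lemma lin_ext_uniq (K : choiceType) (M : lmodType k)
    (F G : {malg k[K]} -> M) :
  linear F -> linear G -> (forall u, F << u >> = G << u >>) -> F =1 G.
Proof.
move=> lF lG FG x.
pose F' := GRing.isLinear.Build k _ _ _ F lF.
pose G' := GRing.isLinear.Build k _ _ _ G lG.
pose FL : {linear _ -> _} := HB.pack F F'.
pose GL : {linear _ -> _} := HB.pack G G'.
change (FL x = GL x); rewrite [x]monalgE !linear_sum.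
apply: eq_bigr => u _.
have -> : << x@_u *g u >> = x@_u *: << u >> :> {malg k[K]}.
  by apply/malgP => v; rewrite mcoeffZ !mcoeffU mulr_natr.
by rewrite !linearZ /= FG.
Qed.

Lemma tens_linear_l (K L : choiceType) (y : {malg k[L]}) :
  linear (fun x : {malg k[K]} => tens x y).
Proof. exact: lin_ext_linear. Qed.

Lemma tens_linear_r (K L : choiceType) (x : {malg k[K]}) :
  linear (fun y : {malg k[L]} => tens x y).
Proof.
move=> c y y'; rewrite /tens {1 3 5}/lin_ext scaler_sumr -big_split /=.
apply: eq_bigr => u _.
by rewrite lin_ext_linear scalerDr !scalerA mulrC.
Qed.

Lemma tensU (K L : choiceType) (u : K) (v : L) :
  tens << u >> << v >> = << (u, v) >>.
Proof. by rewrite /tens !lin_extU. Qed.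

Lemma tens_liftE (K L : choiceType) (M : lmodType k)
    (B : {malg k[K]} -> {malg k[L]} -> M) :
    (forall y, linear (B^~ y)) -> (forall x, linear (B x)) ->
  forall x y, tens_lift B (tens x y) = B x y.
Proof.
move=> Bl Br x y; move: x; apply: lin_ext_uniq => [|//|u].
  by move=> c x x'; rewrite tens_linear_l /tens_lift lin_ext_linear.
move: y; apply: lin_ext_uniq => [|//|v].
  by move=> c y y'; rewrite tens_linear_r /tens_lift lin_ext_linear.
by rewrite tensU /tens_lift lin_extU.
Qed.

Lemma tens_lift_uniq (K L : choiceType) (M : lmodType k)
    (F G : {malg k[(K * L)%type]} -> M) : linear F -> linear G ->
  (forall x y, F (tens x y) = G (tens x y)) -> F =1 G.
Proof.
by move=> lF lG FG; apply: lin_ext_uniq => // -[u v]; rewrite -tensU.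
Qed.

End FreeModule.

Section Hopf.
Context {k : fieldType}.

Record hopf_data (K : choiceType) := HopfData {
  hmul : {malg k[K]} -> {malg k[K]} -> {malg k[K]};
  hone : {malg k[K]};
  hcomul : {malg k[K]} -> {malg k[(K * K)%type]};
  hcounit : {malg k[K]} -> k }.

Definition is_algebra (K : choiceType) (H : hopf_data K) : Prop :=
  [/\ forall y, linear ((hmul H)^~ y),
      forall x, linear (hmul H x),
      associative (hmul H),
      left_id (hone H) (hmul H)
    & right_id (hone H) (hmul H)].

Definition is_coalgebra (K : choiceType) (H : hopf_data K) : Prop :=
  [/\ linear (hcomul H),
      linear (hcounit H : _ -> k^o),
      forall x, tens_assoc (tens_map (hcomul H) id (hcomul H x))
                = tens_map id (hcomul H) (hcomul H x),
      forall x, tens_lift (fun y z => hcounit H y *: z) (hcomul H x) = x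
    & forall x, tens_lift (fun y z => hcounit H z *: y) (hcomul H x) = x].

(* (x (x) y) (x' (x) y') = x x' (x) y y' *)
Definition tens_mul (K : choiceType) (H : hopf_data K)
    (s t : {malg k[(K * K)%type]}) : {malg k[(K * K)%type]} :=
  tens_lift (fun x y =>
    tens_lift (fun x' y' => tens (hmul H x x') (hmul H y y')) t) s.

Definition is_bialgebra (K : choiceType) (H : hopf_data K) : Prop :=
  [/\ is_algebra H, is_coalgebra H,
      (forall x y, hcomul H (hmul H x y)
                   = tens_mul H (hcomul H x) (hcomul H y))
        /\ hcomul H (hone H) = tens (hone H) (hone H)
    & (forall x y, hcounit H (hmul H x y) = hcounit H x * hcounit H y)
        /\ hcounit H (hone H) = 1].

Definition is_antipode (K : choiceType) (H : hopf_data K)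
    (S : {malg k[K]} -> {malg k[K]}) : Prop :=
  [/\ linear S,
      forall x, tens_lift (hmul H) (tens_map S id (hcomul H x))
                = hcounit H x *: hone H
    & forall x, tens_lift (hmul H) (tens_map id S (hcomul H x))
                = hcounit H x *: hone H].

Definition is_hopf_algebra (K : choiceType) (H : hopf_data K) : Prop :=
  is_bialgebra H /\ exists S, is_antipode H S.

Definition is_hopf_morphism (K L : choiceType)
    (H : hopf_data K) (H' : hopf_data L)
    (f : {malg k[K]} -> {malg k[L]}) : Prop :=
  [/\ linear f,
      (forall x y, f (hmul H x y) = hmul H' (f x) (f y))
        /\ f (hone H) = hone H',
      forall x, hcomul H' (f x) = tens_map f f (hcomul H x),
      forall x, hcounit H' (f x) = hcounit H x
    & forall S S', is_antipode H S -> is_antipode H' S' ->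
        forall x, f (S x) = S' (f x)].

Definition is_hopf_isomorphism (K L : choiceType)
    (H : hopf_data K) (H' : hopf_data L)
    (f : {malg k[K]} -> {malg k[L]}) : Prop :=
  [/\ is_hopf_algebra H, is_hopf_algebra H', is_hopf_morphism H H' f
    & bijective f].

End Hopf.

Arguments hopf_data : clear implicits.

Fixpoint compositions (n : nat) : seq (seq nat) :=
  if n is n'.+1 then
    map (cons 1%N) (compositions n') ++
    map (fun I => (head 0%N I).+1 :: behead I)
      (filter (fun I => I != [::]) (compositions n'))
  else [:: [::]].

Lemma mem_compositions n I :
  (I \in compositions n) = all (leq 1) I && (sumn I == n).
Proof.
elim: n I => [|n IHn] [|i I] //=.
- by rewrite inE; case: i => //= i; rewrite andbF.
- by rewrite mem_cat; apply/negbTE/norP; split; apply/mapP => -[].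
rewrite mem_cat; apply/orP/idP.
  case=> /mapP[J].
    by rewrite IHn => /andP[J0 /eqP sJ] [-> ->]; rewrite /= J0 sJ add1n eqxx.
  rewrite mem_filter IHn; case: J => [|j J] //= /andP[/andP[j0 J0] /eqP sJ].
  by case=> -> ->; rewrite /= J0 addSn sJ eqxx.
case: i => [|[|i]] //=.
  move=> /andP[I0]; rewrite add1n eqSS => sI; left.
  by rewrite map_f // IHn I0.
move=> /andP[I0]; rewrite addSn eqSS => sI; right.
by apply/mapP; exists (i.+1 :: I) => //; rewrite mem_filter IHn /= I0.
Qed.

Lemma compositions_uniq n : uniq (compositions n).
Proof.
elim: n => [|n IHn] //=; rewrite cat_uniq map_inj_uniq ?IHn; last first.
  by move=> I J [].
rewrite andTb; apply/andP; split.
  apply/hasPn => I /mapP[[|j J]]; rewrite mem_filter //= mem_compositions /=.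
  by case: j => // j _ ->; apply/mapP => -[].
rewrite map_inj_in_uniq ?filter_uniq // => -[|i I] [|j J];
  by rewrite !mem_filter //= => _ _ [-> ->].
Qed.

(* The alphabet with zero adjoined is option A, with None for 0. *)
Section QuasiShuffle.
Context (k : fieldType) (A : choiceType).
Variable op : option A -> option A -> option A.

Local Notation NC := {malg k[{fmonom A}]}.

Definition word (w : seq A) : NC := << FMonom w >>.

Definition letter (o : option A) : NC := if o is Some a then word [:: a] else 0.

Fixpoint shuffle_word (u : seq A) : seq A -> NC :=
  if u is a :: u' then
    fix shuffle_u (v : seq A) : NC :=
      if v is b :: v' then
        letter (Some a) * shuffle_word u' v + letter (Some b) * shuffle_u v'
      else word u
  else word.

Fixpoint quasi_shuffle_word (u : seq A) : seq A -> NC :=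
  if u is a :: u' then
    fix quasi_shuffle_u (v : seq A) : NC :=
      if v is b :: v' then
        letter (Some a) * quasi_shuffle_word u' v
        + letter (Some b) * quasi_shuffle_u v'
        + letter (op (Some a) (Some b)) * quasi_shuffle_word u' v'
      else word u
  else word.

Definition shuffle (x y : NC) : NC :=
  lin_ext (fun u : {fmonom A} =>
    lin_ext (fun v : {fmonom A} => shuffle_word u v) y) x.

Definition quasi_shuffle (x y : NC) : NC :=
  lin_ext (fun u : {fmonom A} =>
    lin_ext (fun v : {fmonom A} => quasi_shuffle_word u v) y) x.

Definition deconcatenation : NC -> {malg k[({fmonom A} * {fmonom A})%type]} :=
  lin_ext (fun w : {fmonom A} =>
    \sum_(i < (size w).+1) tens (word (take i w)) (word (drop i w))).

Definition nc_counit : NC -> k :=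
  lin_ext (fun w : {fmonom A} => ((w == [::] :> seq A)%:R : k^o)).

Definition shuffle_hopf : hopf_data k {fmonom A} :=
  HopfData shuffle (word [::]) deconcatenation nc_counit.

Definition quasi_shuffle_hopf : hopf_data k {fmonom A} :=
  HopfData quasi_shuffle (word [::]) deconcatenation nc_counit.

(* [a_1, ..., a_m]; the value on the empty sequence is never used. *)
Fixpoint bracket_seq (s : seq A) : option A :=
  match s with
  | [::] => None
  | [:: a] => Some a
  | a :: s' => op (Some a) (bracket_seq s')
  end.

Definition composition_action (I : seq nat) (w : seq A) : NC :=
  \prod_(s <- reshape I w) letter (bracket_seq s).

(* For the empty word the only term is that of the empty composition, so    *)
(* that qexp (word [::]) = word [::].                                       *)
Definition qexp : NC -> NC :=
  lin_ext (fun w : {fmonom A} =>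
    \sum_(I <- compositions (size w))
      (\prod_(i <- I) (i`!)%:R)^-1 *: composition_action I w).

End QuasiShuffle.

Arguments qexp k {A} op.
Arguments quasi_shuffle_hopf k {A} op.

(* Main.v *)
Require Import Defs.
From HB Require Import structures.
From mathcomp Require Import all_boot all_order all_algebra.
From mathcomp Require Import finmap monalg.
From mathcomp Require Import boolp classical_sets cardinality reals.
From mathcomp Require Import complex.

(* Write p(w) = [w] / |w|! for the component of exp(w) on single letters.
   Splitting off the first block of a composition gives
   exp(w) = eps(w) 1 + sum_(w = uv) p(u) exp(v), so exp is compatible with
   deconcatenation by coassociativity.  An element z is recovered from eps(z)
   and Delta(z) as z = eps(z) 1 + sum pi(z') z'', where pi is the projection
   onto single letters; hence the multiplicativity of exp reduces, by induction
   on length, to pi(exp(u sh v)) = pi(exp u * exp v).  This holds because all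
   the shuffles of u and v have the same bracket, so that the left-hand side is
   binom(|u|+|v|, |u|) [uv] / (|u|+|v|)! = [[u],[v]] / (|u|! |v|!).  Finally exp
   is bijective because w - exp(w) is a combination of words shorter than w.
   The shuffle product is the quasi-shuffle product of the zero bracket, so the
   Hopf algebra axioms need only be checked once. *)

Set Implicit Arguments.
Unset Strict Implicit.
Unset Printing Implicit Defensive.

Import GRing.Theory.
Local Open Scope ring_scope.

(** * Linear maps as functions with a linearity hypothesis *)

Section LinearMaps.
Context {k : fieldType} {M N P : lmodType k}.

Section OneMap.
Variable (F : M -> N).
Hypothesis linF : linear F.

Let FL : {linear M -> N} := HB.pack F (GRing.isLinear.Build k _ _ _ F linF).

Lemma lin0 : F 0 = 0. Proof. exact: (linear0 FL). Qed.

Lemma linD x y : F (x + y) = F x + F y. Proof. exact: (linearD FL). Qed.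

Lemma linN x : F (- x) = - F x. Proof. exact: (linearN FL). Qed.

Lemma linZ c x : F (c *: x) = c *: F x. Proof. by rewrite -[c *: x]addr0 linF lin0 addr0. Qed.

Lemma lin_sum I (r : seq I) (Q : pred I) (E : I -> M) :
  F (\sum_(i <- r | Q i) E i) = \sum_(i <- r | Q i) F (E i).
Proof. exact: (linear_sum FL). Qed.

End OneMap.

Lemma lin_id : linear (@id M). Proof. by []. Qed.

Lemma lin_comp (F : M -> N) (G : N -> P) :
  linear F -> linear G -> linear (fun x => G (F x)).
Proof. by move=> lF lG c x y; rewrite lF lG. Qed.

Lemma lin_add (F G : M -> N) :
  linear F -> linear G -> linear (fun x => F x + G x).
Proof. by move=> lF lG c x y; rewrite lF lG scalerDr addrACA. Qed.

Lemma lin_opp (F : M -> N) : linear F -> linear (fun x => - F x).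
Proof. by move=> lF c x y; rewrite lF opprD scalerN. Qed.

Lemma lin_scale (F : M -> k^o) (v : N) :
  linear F -> linear (fun x => F x *: v).
Proof. by move=> lF c x y; rewrite lF scalerDl scalerA. Qed.

End LinearMaps.

(** * Tensor products of maps and of algebras *)

Section Tensor.
Context {k : fieldType}.
Implicit Types K L : choiceType.

Lemma tens_lift_linear K L (M : lmodType k)
  (B : {malg k[K]} -> {malg k[L]} -> M) : linear (tens_lift B).
Proof. exact: lin_ext_linear. Qed.

Lemma tens_map_linear K L K' L' (f : {malg k[K]} -> {malg k[K']})
  (g : {malg k[L]} -> {malg k[L']}) : linear (tens_map f g).
Proof. exact: lin_ext_linear. Qed.

Lemma tens_mapE K L K' L' (f : {malg k[K]} -> {malg k[K']})
    (g : {malg k[L]} -> {malg k[L']}) x y :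
  linear f -> linear g -> tens_map f g (tens x y) = tens (f x) (g y).
Proof.
move=> lf lg; rewrite /tens_map tens_liftE // => z.
  by move=> c a b; rewrite lf tens_linear_l.
by move=> c a b; rewrite lg tens_linear_r.
Qed.

Lemma tens_assocE K L M (x : {malg k[K]}) (y : {malg k[L]}) (z : {malg k[M]}) :
  tens_assoc (tens (tens x y) z) = tens x (tens y z).
Proof.
have lin_assoc : linear (@tens_assoc k K L M) by exact: lin_ext_linear.
move: x; apply: lin_ext_uniq => [c a b|c a b|u].
- by rewrite !tens_linear_l lin_assoc.
- by rewrite tens_linear_l.
move: y; apply: lin_ext_uniq => [c a b|c a b|v].
- by rewrite tens_linear_r tens_linear_l lin_assoc.
- by rewrite tens_linear_l tens_linear_r.
move: z; apply: lin_ext_uniq => [c a b|c a b|w].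
- by rewrite tens_linear_r lin_assoc.
- by rewrite !tens_linear_r.
by rewrite !tensU /tens_assoc lin_extU.
Qed.

Section TensMul.
Variables (K : choiceType) (H : hopf_data k K).
Hypothesis lin_mull : forall y, linear ((hmul H)^~ y).
Hypothesis lin_mulr : forall x, linear (hmul H x).

Lemma tens_mul_linear_l t : linear ((tens_mul H)^~ t).
Proof. by move=> c s s'; rewrite /tens_mul tens_lift_linear. Qed.

Lemma tens_mul_linear_r s : linear (tens_mul H s).
Proof.
move=> c t t'; rewrite /tens_mul /tens_lift {1 3 5}/lin_ext.
rewrite scaler_sumr -big_split; apply: eq_bigr => u _ /=.
by rewrite lin_ext_linear scalerDr !scalerA mulrC.
Qed.

Lemma tens_mulE x y x' y' :
  tens_mul H (tens x y) (tens x' y') = tens (hmul H x x') (hmul H y y').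
Proof.
pose B u v := fun a b : {malg k[K]} => tens (hmul H u a) (hmul H v b).
have BE u v a b : tens_lift (B u v) (tens a b) = B u v a b.
  rewrite tens_liftE // => z c p q; rewrite /B lin_mulr.
    by rewrite tens_linear_l.
  by rewrite tens_linear_r.
have TE : (fun u v => tens_lift (B u v) (tens x' y'))
          = (fun u v => tens (hmul H u x') (hmul H v y')).
  by apply: funext => u; apply: funext => v; exact: BE.
change (tens_lift (fun u v => tens_lift (B u v) (tens x' y')) (tens x y)
        = tens (hmul H x x') (hmul H y y')).
rewrite TE; apply: (tens_liftE (B := fun u v => _)) => z c a b.
  by rewrite (lin_mull x' c a b) tens_linear_l.
by rewrite (lin_mull y' c a b) tens_linear_r.
Qed.

End TensMul.
End Tensor.

(** * Sums over the factorizations of a word *)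

Section Splits.
Variable A : choiceType.
Implicit Types (w u v : seq A) (a : A).

(** A recursive enumeration of the factorizations, so that sums indexed by cutting positions can be
    treated by induction on the word. *)
Fixpoint splits w : seq (seq A * seq A) :=
  ([::], w) :: if w is a :: w' then [seq (a :: p.1, p.2) | p <- splits w']
               else [::].

Lemma splits_size w p : p \in splits w -> (size p.1 + size p.2 = size w)%N.
Proof.
elim: w p => [|a w IHw] p; rewrite !inE; first by move/eqP->.
case/orP => [/eqP-> //|/mapP[q /IHw qw ->]] /=.
by rewrite addSn qw.
Qed.

Section Sums.
Variable M : zmodType.

Lemma big_splits_cons (F : seq A -> seq A -> M) a w :
  \sum_(p <- splits (a :: w)) F p.1 p.2
  = F [::] (a :: w) + \sum_(p <- splits w) F (a :: p.1) p.2.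
Proof. by rewrite big_cons big_map. Qed.

Lemma big_splits_first (F : seq A -> seq A -> M) w :
  \sum_(p <- splits w) F p.1 p.2
  = F [::] w + \sum_(p <- splits w | p.1 != [::]) F p.1 p.2.
Proof.
rewrite (bigID (fun p => p.1 == [::])) /=; congr (_ + _).
case: w => [|a w]; first by rewrite /= big_cons big_nil /= addr0.
rewrite /= big_cons /= big_map big1 ?addr0 //.
Qed.

Lemma big_take_drop (F : seq A -> seq A -> M) w :
  \sum_(i < (size w).+1) F (take i w) (drop i w)
  = \sum_(p <- splits w) F p.1 p.2.
Proof.
elim: w F => [|a w IHw] F; first by rewrite big_ord1 big_seq1.
rewrite big_ord_recl big_splits_cons -(IHw (fun u => F (a :: u))) take0.
by congr (_ + _); apply: eq_bigr => i _.
Qed.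

(** Either order of cutting enumerates the factorizations into three factors. In the induction the
    terms with empty first factor agree at once, and the others carry the first letter into the
    first factor. *)
Lemma splits_coassoc (F : seq A -> seq A -> seq A -> M) w :
  \sum_(p <- splits w) \sum_(q <- splits p.1) F q.1 q.2 p.2
  = \sum_(p <- splits w) \sum_(q <- splits p.2) F p.1 q.1 q.2.
Proof.
elim: w F => [|a w IHw] F; first by rewrite !big_seq1.
rewrite (big_splits_cons (fun u v => \sum_(q <- splits u) F q.1 q.2 v)).
rewrite (big_splits_cons (fun u v => \sum_(q <- splits v) F u q.1 q.2)).
rewrite [X in X + _ = _]big_seq1 (big_splits_cons (F [::])) -addrA; congr (_ + _).
rewrite -(IHw (fun u => F (a :: u))) -big_split /=; apply: eq_bigr => p _.
by rewrite (big_splits_cons (fun x y => F x y p.2)).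
Qed.

End Sums.

Lemma splits_counit_r (k : fieldType) (M : lmodType k) (f : seq A -> M) w :
  \sum_(p <- splits w) (p.2 == [::])%:R *: f p.1 = f w.
Proof.
elim: w f => [|a w IHw] f; first by rewrite big_seq1 scale1r.
rewrite (big_splits_cons (fun u v => (v == [::])%:R *: f u)) /= scale0r add0r.
exact: (IHw (fun u => f (a :: u))).
Qed.

Lemma splits_counit_l (k : fieldType) (M : lmodType k) (f : seq A -> M) w :
  \sum_(p <- splits w) (p.1 == [::])%:R *: f p.2 = f w.
Proof.
case: w => [|a w]; first by rewrite big_seq1 scale1r.
rewrite (big_splits_cons (fun u v => (u == [::])%:R *: f v)) /= scale1r.
by rewrite big1 ?addr0 // => p _; rewrite scale0r.
Qed.

End Splits.

(** * Concatenation and the deconcatenation coalgebra *)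

Section Words.
Variables (k : fieldType) (A : choiceType).
Local Notation NC := {malg k[{fmonom A}]}.
Local Notation NC2 := {malg k[({fmonom A} * {fmonom A})%type]}.
Local Notation word := (@Defs.word k A).
Local Notation letter := (@Defs.letter k A).
Implicit Types (w u v : seq A) (a : A) (o : option A) (x y z : NC).

Lemma word_fmonom (u : {fmonom A}) : << u >> = word u :> NC.
Proof. by rewrite /Defs.word fmK. Qed.

Lemma lin_ext_word (M : lmodType k) (f : {fmonom A} -> M) u :
  lin_ext f (word u) = f (FMonom u).
Proof. exact: lin_extU. Qed.

Lemma eq_on_words (M : lmodType k) (F G : NC -> M) :
  linear F -> linear G -> (forall u, F (word u) = G (word u)) -> F =1 G.
Proof.
by move=> lF lG FG; apply: lin_ext_uniq => // u; rewrite word_fmonom FG.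
Qed.

Lemma word_nil : word [::] = 1.
Proof. by rewrite /Defs.word -fmoneE. Qed.

Lemma word_cat u v : word (u ++ v) = word u * word v.
Proof.
rewrite malgM_def fgmulUU mulr1 /Defs.word; congr << _ >>.
by apply/eqP; rewrite fmP fmM.
Qed.

Lemma malgU_scale c (u : {fmonom A}) : << c *g u >> = c *: << u >> :> NC.
Proof. by rewrite -mul_malgC malgM_def fgmulUU mulr1 mul1m. Qed.

(** A scalar acts as multiplication by a multiple of the empty word, which commutes with every
    word. *)
Lemma concat_scaler c x y : x * (c *: y) = c *: (x * y).
Proof.
rewrite -mul_malgC mulrA [RHS]scalerAl; congr (_ * _).
move: x; apply: eq_on_words => [d p q|d p q|u].
- by rewrite mulrDl scalerAl.
- by rewrite scalerDr !scalerA mulrC.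
by rewrite malgM_def fgmulUU mul1r mulm1 malgU_scale.
Qed.

Lemma concat_linear_r x : linear (fun y => x * y).
Proof. by move=> c y y'; rewrite mulrDr concat_scaler. Qed.

Fact lcons_key : unit. Proof. exact: tt. Qed.

(* The operations on {malg k[_]} are locked because unification otherwise
   unfolds them down to finitely supported functions. *)
Definition lcons : option A -> NC -> NC :=
  locked_with lcons_key (fun o x => letter o * x).

Lemma lconsE o x : lcons o x = letter o * x.
Proof. by rewrite /lcons unlock. Qed.

Lemma lcons_linear o : linear (lcons o).
Proof. by move=> c x y; rewrite !lconsE concat_linear_r. Qed.

Lemma lcons_None x : lcons None x = 0.
Proof. by rewrite lconsE; exact: mul0r. Qed.

Lemma lcons_word a u : lcons (Some a) (word u) = word (a :: u).
Proof. by rewrite lconsE -[a :: u]cat1s word_cat. Qed.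

Fact tensor_key : unit. Proof. exact: tt. Qed.

Definition tensor : NC -> NC -> NC2 := locked_with tensor_key (@tens k _ _).

Lemma tensorE : tensor = @tens k _ _. Proof. by rewrite /tensor unlock. Qed.

Lemma tensor_linear_l y : linear (tensor^~ y).
Proof. rewrite tensorE; exact: tens_linear_l. Qed.

Lemma tensor_linear_r x : linear (tensor x).
Proof. rewrite tensorE; exact: tens_linear_r. Qed.

Lemma eq_on_tensor (M : lmodType k) (F G : NC2 -> M) :
  linear F -> linear G -> (forall x y, F (tensor x y) = G (tensor x y)) ->
  F =1 G.
Proof. rewrite tensorE; exact: tens_lift_uniq. Qed.

Lemma deconcatenation_linear : linear (@deconcatenation k A).
Proof. exact: lin_ext_linear. Qed.

Lemma deconcatenation_word w :
  deconcatenation (word w)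
  = \sum_(p <- splits w) tensor (word p.1) (word p.2).
Proof.
rewrite /deconcatenation lin_ext_word tensorE.
by rewrite
  -(big_take_drop (fun u v => tens (word u) (word v))).
Qed.

Lemma tens_lift_deconcatenation (M : lmodType k) (B : NC -> NC -> M) w :
  tens_lift B (deconcatenation (word w))
  = \sum_(p <- splits w) B (word p.1) (word p.2).
Proof.
rewrite deconcatenation_word (lin_sum (tens_lift_linear B)).
by apply: eq_bigr => p _; rewrite tensorE tensU /tens_lift lin_extU.
Qed.

Lemma tens_map_deconcatenation (K L : choiceType) (f : NC -> {malg k[K]})
    (g : NC -> {malg k[L]}) w :
  tens_map f g (deconcatenation (word w))
  = \sum_(p <- splits w) tens (f (word p.1)) (g (word p.2)).
Proof. exact: tens_lift_deconcatenation. Qed.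

Lemma nc_counit_linear : linear (@nc_counit k A : NC -> k^o).
Proof. exact: lin_ext_linear. Qed.

Lemma nc_counit_word u : nc_counit (word u) = (u == [::])%:R.
Proof. by rewrite /nc_counit lin_ext_word. Qed.

Lemma nc_counit_lcons o x : nc_counit (lcons o x) = 0.
Proof.
case: o => [a|]; last by rewrite lcons_None (lin0 nc_counit_linear).
move: x; apply: (@eq_on_words k^o) => [||u].
- exact: lin_comp (lcons_linear _) nc_counit_linear.
- by move=> c x y; rewrite scaler0 addr0.
by rewrite lcons_word nc_counit_word.
Qed.

Fact lead_key : unit. Proof. exact: tt. Qed.

Definition lead o : NC2 -> NC2 :=
  locked_with lead_key (tens_map (lcons o) id).

Lemma lead_linear o : linear (lead o).
Proof. by rewrite /lead unlock; exact: tens_map_linear. Qed.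

Lemma lead_tensor o x y : lead o (tensor x y) = tensor (lcons o x) y.
Proof. by rewrite tensorE /lead unlock tens_mapE //; exact: lcons_linear. Qed.

(** Either the left factor is empty or it begins with the leading letter. Allowing [o] to be zero,
    where both sides vanish, lets the rule apply to a bracket that may be 0. *)
Lemma deconcatenation_lcons o x :
  deconcatenation (lcons o x)
  = tensor (word [::]) (lcons o x) + lead o (deconcatenation x).
Proof.
case: o => [a|]; last first.
  rewrite lcons_None (lin0 deconcatenation_linear).
  rewrite (lin0 (tensor_linear_r _)) add0r.
  move: (deconcatenation x); apply: eq_on_tensor => [c p q||u v].
  - by rewrite scaler0 addr0.
  - exact: lead_linear.
  by rewrite lead_tensor lcons_None (lin0 (tensor_linear_l _)).
move: x; apply: eq_on_words => [||u].
- exact: lin_comp (lcons_linear _) deconcatenation_linear.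
- apply: lin_add; last exact: lin_comp deconcatenation_linear (lead_linear _).
  exact: lin_comp (lcons_linear _) (tensor_linear_r _).
rewrite lcons_word !deconcatenation_word.
rewrite (big_splits_cons (fun u v => tensor (word u) (word v))).
congr (_ + _); rewrite (lin_sum (lead_linear _)); apply: eq_bigr => p _ /=.
by rewrite lead_tensor lcons_word.
Qed.

Lemma deconcatenation_coassoc x :
  tens_assoc (tens_map (@deconcatenation k A) id (deconcatenation x))
  = tens_map id (@deconcatenation k A) (deconcatenation x).
Proof.
have dl := deconcatenation_linear.
have al : linear (@tens_assoc k {fmonom A} {fmonom A} {fmonom A}).
  exact: lin_ext_linear.
move: x; apply: eq_on_words => [||w].
- exact: lin_comp (lin_comp dl (tens_map_linear _ _)) al.
- exact: lin_comp dl (tens_map_linear _ _).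
rewrite !tens_map_deconcatenation (lin_sum al).
transitivity (\sum_(p <- splits w) \sum_(q <- splits p.1)
    tens (word q.1) (tens (word q.2) (word p.2))).
  apply: eq_bigr => p _.
  rewrite deconcatenation_word tensorE (lin_sum (tens_linear_l _)) (lin_sum al).
  by apply: eq_bigr => q _; rewrite tens_assocE.
rewrite (splits_coassoc (fun u v w => tens (word u) (tens (word v) (word w)))).
apply: eq_bigr => p _.
by rewrite deconcatenation_word tensorE (lin_sum (tens_linear_r _)).
Qed.

Lemma deconcatenation_counit_l x :
  tens_lift (fun y z => nc_counit y *: z) (deconcatenation x) = x.
Proof.
move: x; apply: eq_on_words => [||w].
- exact: lin_comp deconcatenation_linear (tens_lift_linear _).
- by [].
rewrite tens_lift_deconcatenation -[RHS]splits_counit_l.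
by apply: eq_bigr => p _; rewrite nc_counit_word.
Qed.

Lemma deconcatenation_counit_r x :
  tens_lift (fun y z => nc_counit z *: y) (deconcatenation x) = x.
Proof.
move: x; apply: eq_on_words => [||w].
- exact: lin_comp deconcatenation_linear (tens_lift_linear _).
- by [].
rewrite tens_lift_deconcatenation -[RHS]splits_counit_r.
by apply: eq_bigr => p _; rewrite nc_counit_word.
Qed.

End Words.

(** * Convolution of functions on words and its inverses *)

Section Convolution.
Variables (k : fieldType) (A : choiceType) (M : lmodType k).
Variables (mul : M -> M -> M) (e : M).
Hypothesis mul_linear_l : forall y, linear (mul^~ y).
Hypothesis mul_linear_r : forall x, linear (mul x).
Hypotheses (mulA : associative mul) (mul1 : left_id e mul) (mulr1 : right_id e mul).
Implicit Types (f g h : seq A -> M) (w : seq A).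

Definition convolution f g w := \sum_(p <- splits w) mul (f p.1) (g p.2).

Definition convolution_unit w : M := (w == [::])%:R *: e.

Lemma convolutionA f g h w :
  convolution f (convolution g h) w = convolution (convolution f g) h w.
Proof.
rewrite /convolution.
under eq_bigr do rewrite (lin_sum (mul_linear_r _)).
under [RHS]eq_bigr do rewrite (lin_sum (mul_linear_l _)).
rewrite (splits_coassoc (fun u v w => mul (mul (f u) (g v)) (h w))).
by apply: eq_bigr => p _; apply: eq_bigr => q _; rewrite mulA.
Qed.

Lemma convolution_unit_l f w : convolution convolution_unit f w = f w.
Proof.
rewrite -[RHS]splits_counit_l; apply: eq_bigr => p _.
by rewrite (linZ (mul_linear_l _)) mul1.
Qed.

Lemma convolution_unit_r f w : convolution f convolution_unit w = f w.
Proof.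
rewrite -[RHS]splits_counit_r; apply: eq_bigr => p _.
by rewrite (linZ (mul_linear_r _)) mulr1.
Qed.

Lemma eq_convolution f f' g g' w :
  f =1 f' -> g =1 g' -> convolution f g w = convolution f' g' w.
Proof. by move=> ff gg; apply: eq_bigr => p _; rewrite ff gg. Qed.

Section Inverse.
Variable f : seq A -> M.
Hypothesis f1 : f [::] = e.

(* Computes convolution h (conv_inv f), by recursion on the word. *)
Fixpoint conv_div h w : M :=
  if w is b :: w' then
    conv_div (fun u => h (b :: u)) w'
    - mul (h [::]) (conv_div (fun u => f (b :: u)) w')
  else h [::].

(** As [f [::] = e], the term with empty left factor in the inverse equation at [b :: w'] is the
    sought value itself; it must be minus the convolution of [fun u => f (b :: u)] with the inverse
    at [w']. *)
Definition conv_inv w : M :=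
  if w is b :: w' then - conv_div (fun u => f (b :: u)) w' else e.

Lemma conv_divE h w : conv_div h w = convolution h conv_inv w.
Proof.
elim: w h => [|b w IHw] h; first by rewrite /convolution big_seq1 mulr1.
rewrite /convolution (big_splits_cons (fun u v => mul (h u) (conv_inv v))) /=.
by rewrite (linN (mul_linear_r _)) [RHS]addrC !IHw.
Qed.

Lemma convolution_inv w : convolution f conv_inv w = convolution_unit w.
Proof.
rewrite /convolution_unit.
case: w => [|b w]; first by rewrite /convolution big_seq1 f1 mul1 scale1r.
rewrite /convolution (big_splits_cons (fun u v => mul (f u) (conv_inv v))) /=.
by rewrite f1 mul1 conv_divE addNr scale0r.
Qed.

End Inverse.

(** A right inverse g of f has a right inverse in turn; by associativity the latter is f, so g is
    also a left inverse. *)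
Lemma conv_inv_convolution f w :
  f [::] = e -> convolution (conv_inv f) f w = convolution_unit w.
Proof.
move=> f1; have g1 : conv_inv f [::] = e by [].
have fE : f =1 conv_inv (conv_inv f).
  move=> v; rewrite -[LHS]convolution_unit_r.
  rewrite -(eq_convolution _ (frefl f) (convolution_inv g1)) convolutionA.
  rewrite (eq_convolution _ (convolution_inv f1) (frefl _)).
  exact: convolution_unit_l.
by rewrite (eq_convolution _ (frefl _) fE) convolution_inv.
Qed.

Lemma convolution_inv_uniq f g h w :
  (forall v, convolution g f v = convolution_unit v) ->
  (forall v, convolution f h v = convolution_unit v) -> g w = h w.
Proof.
move=> gf fh; rewrite -[LHS]convolution_unit_r.
rewrite -(eq_convolution _ (frefl g) fh) convolutionA.
by rewrite (eq_convolution _ gf (frefl h)) convolution_unit_l.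
Qed.

End Convolution.

(** * The quasi-shuffle algebra *)

Section QuasiShuffleAlgebra.
Variables (k : fieldType) (A : choiceType).
Variable op : option A -> option A -> option A.
Hypothesis op0 : forall a, op a None = None.
Hypothesis opC : forall a b, op a b = op b a.
Hypothesis opA : forall a b c, op (op a b) c = op a (op b c).
Local Notation NC := {malg k[{fmonom A}]}.
Local Notation word := (@Defs.word k A).
Local Notation letter := (@Defs.letter k A).
Implicit Types (w u v : seq A) (a : A) (o p : option A) (x y z : NC).

Fact qs_key : unit. Proof. exact: tt. Qed.

Definition qs : NC -> NC -> NC := locked_with qs_key (quasi_shuffle op).

Lemma qsE : qs = quasi_shuffle op. Proof. by rewrite /qs unlock. Qed.

Lemma qs_linear_l y : linear (qs^~ y).
Proof. by move=> c x x'; rewrite qsE /quasi_shuffle lin_ext_linear. Qed.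

Lemma qs_linear_r x : linear (qs x).
Proof.
rewrite qsE => c y y'.
rewrite /quasi_shuffle {1 3 5}/lin_ext scaler_sumr -big_split.
apply: eq_bigr => u _ /=.
by rewrite lin_ext_linear scalerDr !scalerA mulrC.
Qed.

Lemma qs_word u v : qs (word u) (word v) = quasi_shuffle_word k op u v.
Proof. by rewrite qsE /quasi_shuffle !lin_ext_word. Qed.

Lemma qs1x : left_id (word [::]) qs.
Proof.
apply: eq_on_words => [||u]; [exact: qs_linear_r|by []|].
by rewrite qs_word.
Qed.

Lemma qsx1 : right_id (word [::]) qs.
Proof.
apply: eq_on_words => [||u]; [exact: qs_linear_l|by []|].
by rewrite qs_word; case: u.
Qed.

Lemma qs0x x : qs 0 x = 0. Proof. exact: lin0 (qs_linear_l x). Qed.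

Lemma qsx0 x : qs x 0 = 0. Proof. exact: lin0 (qs_linear_r x). Qed.

(** Bilinearity extends the defining recursion to polynomial tails. If one of the leading letters is
    0 every term vanishes, so products involving [a,b] need no case distinction. *)
Lemma qs_lcons o p x y :
  qs (lcons o x) (lcons p y)
  = lcons o (qs x (lcons p y)) + lcons p (qs (lcons o x) y)
    + lcons (op o p) (qs x y).
Proof.
case: o => [a|]; last first.
  by rewrite opC op0 !lcons_None !qs0x (lin0 (lcons_linear _)) !addr0.
case: p => [b|]; last first.
  by rewrite op0 !lcons_None !qsx0 (lin0 (lcons_linear _)) !addr0.
move: x; apply: eq_on_words => [c x x'|c x x'|u].
- by rewrite lcons_linear qs_linear_l.
- rewrite lcons_linear !qs_linear_l !lcons_linear !scalerDr.
  by rewrite [LHS](AC (2*2*2) ((1*3*5)*(2*4*6))).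
move: y; apply: eq_on_words => [c x x'|c x x'|v].
- by rewrite lcons_linear qs_linear_r.
- rewrite lcons_linear !qs_linear_r !lcons_linear !scalerDr.
  by rewrite [LHS](AC (2*2*2) ((1*3*5)*(2*4*6))).
by rewrite !lcons_word !qs_word /= !lconsE.
Qed.

(** Induction on the total length: expanding both bracketings by leading letter reduces to triples
    in which one, two or all three words have lost their first letter, which accounts for the seven
    instances of the hypothesis. *)
Lemma qsA : associative qs.
Proof.
move=> x y z; move: x; apply: eq_on_words => [c x x'|c x x'|u].
- by rewrite qs_linear_l.
- by rewrite !qs_linear_l.
move: y; apply: eq_on_words => [c x x'|c x x'|v].
- by rewrite qs_linear_l qs_linear_r.
- by rewrite qs_linear_r qs_linear_l.
move: z; apply: eq_on_words => [c x x'|c x x'|w].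
- by rewrite !qs_linear_r.
- by rewrite qs_linear_r.
apply: esym; have [n] := ubnP (size u + size v + size w).
elim: n u v w => // n IHn [|a u] v w; first by rewrite !qs1x.
case: v => [|b v]; first by rewrite qs1x qsx1.
case: w => [|c w]; first by rewrite !qsx1.
rewrite /= !(addSn, addnS) !ltnS => ltn.
have IH u1 v1 w1 : (size u1 + size v1 + size w1 <=
    (size u + size v + size w).+2)%N ->
  qs (qs (word u1) (word v1)) (word w1) = qs (word u1) (qs (word v1) (word w1)).
  by move=> le1; rewrite IHn // (leq_ltn_trans le1).
have H1 := IH u (b :: v) (c :: w); have H2 := IH (a :: u) v (c :: w).
have H3 := IH u v (c :: w); have H4 := IH (a :: u) (b :: v) w.
have H5 := IH u (b :: v) w; have H6 := IH (a :: u) v w.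
have H7 := IH u v w.
move: H1 H2 H3 H4 H5 H6 H7.
rewrite /= !(addSn, addnS) !(leqnn, leqW) // -!lcons_word.
clear ltn IH IHn; move: (word u) (word v) (word w) => {}u {}v {}w.
move=> /(_ isT) H1 /(_ isT) H2 /(_ isT) H3 /(_ isT) H4.
move=> /(_ isT) H5 /(_ isT) H6 /(_ isT) H7.
have bc := qs_lcons (Some b) (Some c) v w.
have ab := qs_lcons (Some a) (Some b) u v.
(* The term led by a on the left and the term led by c on the right still contain an unexpanded
   product. [Ea] and [Ec] expand them, [H4] putting the latter in the bracketing of the right-hand
   side; each side then has eleven terms, which are matched by a permutation. *)
have Ea := congr1 (fun x => lcons (Some a) (qs u x)) bc.
have Ec := congr1 (fun x => lcons (Some c) (qs x w)) ab.
rewrite /= !(linD (qs_linear_l _), linD (qs_linear_r _), linD (lcons_linear _)) H4 in Ea Ec.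
rewrite [in LHS]ab [in RHS]bc !(linD (qs_linear_l _)) !(linD (qs_linear_r _)).
rewrite !qs_lcons H1 H2 H3 H5 H6 H7 -opA Ea.
by rewrite Ec [LHS](AC (5*3*3) ((1*6*9)*(2*(4*7*10)*5)*(3*8*11))).
Qed.

End QuasiShuffleAlgebra.

(** * The quasi-shuffle Hopf algebra *)

Section QuasiShuffleHopf.
Variables (k : fieldType) (A : choiceType).
Variable op : option A -> option A -> option A.
Hypothesis op0 : forall a, op a None = None.
Hypothesis opC : forall a b, op a b = op b a.
Hypothesis opA : forall a b c, op (op a b) c = op a (op b c).
Local Notation NC := {malg k[{fmonom A}]}.
Local Notation NC2 := {malg k[({fmonom A} * {fmonom A})%type]}.
Local Notation word := (@Defs.word k A).
Local Notation letter := (@Defs.letter k A).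
Local Notation qs := (@qs k A op).
Implicit Types (w u v : seq A) (a : A) (o p : option A) (x y z : NC).
Implicit Types (s t : NC2).

Let qsl := @qs_linear_l k A op.
Let qsr := @qs_linear_r k A op.

Lemma nc_counit_qs x y : nc_counit (qs x y) = nc_counit x * nc_counit y.
Proof.
have el := @nc_counit_linear k A.
move: x; apply: (@eq_on_words _ _ k^o) => [c x x'|c x x'|u].
- by rewrite qsl el.
- by rewrite el /= mulrDl -mulrA.
move: y; apply: (@eq_on_words _ _ k^o) => [c x x'|c x x'|v].
- by rewrite qsr el.
- by rewrite el /= mulrDr mulrCA.
case: u => [|a u]; first by rewrite qs1x !nc_counit_word mul1r.
case: v => [|b v]; first by rewrite qsx1 !nc_counit_word mulr1.
rewrite -!lcons_word (qs_lcons op0 opC) !(linD el) !nc_counit_lcons.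
by rewrite !addr0 mul0r.
Qed.

Definition qs_hopf : hopf_data k {fmonom A} :=
  HopfData qs (word [::]) (@deconcatenation k A) (@nc_counit k A).

Lemma qs_hopfE : qs_hopf = quasi_shuffle_hopf k op.
Proof. by rewrite /qs_hopf qsE. Qed.

Fact qs2_key : unit. Proof. exact: tt. Qed.

Definition qs2 : NC2 -> NC2 -> NC2 := locked_with qs2_key (tens_mul qs_hopf).

Lemma qs2_linear_l t : linear (qs2^~ t).
Proof. by move=> c s s'; rewrite /qs2 unlock tens_mul_linear_l. Qed.

Lemma qs2_linear_r s : linear (qs2 s).
Proof. by rewrite /qs2 unlock; exact: tens_mul_linear_r. Qed.

Lemma qs2_tensor x y x' y' :
  qs2 (tensor x y) (tensor x' y') = tensor (qs x x') (qs y y').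
Proof. by rewrite tensorE /qs2 unlock; exact: (@tens_mulE _ _ qs_hopf qsl qsr). Qed.

Lemma qs2_big (f g : seq A -> NC) u v :
  qs2 (\sum_(p <- splits u) tensor (f p.1) (f p.2))
      (\sum_(q <- splits v) tensor (g q.1) (g q.2))
  = \sum_(p <- splits u) \sum_(q <- splits v)
      tensor (qs (f p.1) (g q.1)) (qs (f p.2) (g q.2)).
Proof.
rewrite (lin_sum (qs2_linear_l _)); apply: eq_bigr => p _.
rewrite (lin_sum (qs2_linear_r _)); apply: eq_bigr => q _.
exact: qs2_tensor.
Qed.

Let q2l := qs2_linear_l.
Let q2r := qs2_linear_r.

(** The second left factor is the empty word, so [o] remains the leading letter of the product. *)
Lemma qs2_lead_l o s y :
  qs2 (lead o s) (tensor (word [::]) y) = lead o (qs2 s (tensor (word [::]) y)).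
Proof.
move: s; apply: eq_on_tensor => [c s t|c s t|x z].
- by rewrite lead_linear q2l.
- by rewrite q2l lead_linear.
by rewrite lead_tensor !qs2_tensor lead_tensor !qsx1.
Qed.

Lemma qs2_lead_r o s y :
  qs2 (tensor (word [::]) y) (lead o s) = lead o (qs2 (tensor (word [::]) y) s).
Proof.
move: s; apply: eq_on_tensor => [c s t|c s t|x z].
- by rewrite lead_linear q2r.
- by rewrite q2r lead_linear.
by rewrite lead_tensor !qs2_tensor lead_tensor !qs1x.
Qed.

(** Counterpart of [qs_lcons] on the tensor square: the recursion acts on the left factors, while
    the right factors are multiplied as they stand. *)
Lemma qs2_lead o p s t :
  qs2 (lead o s) (lead p t)
  = lead o (qs2 s (lead p t)) + lead p (qs2 (lead o s) t)
    + lead (op o p) (qs2 s t).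
Proof.
move: s; apply: eq_on_tensor => [c s s'|c s s'|x y].
- by rewrite lead_linear q2l.
- rewrite lead_linear !q2l !lead_linear !scalerDr.
  by rewrite [LHS](AC (2*2*2) ((1*3*5)*(2*4*6))).
move: t; apply: eq_on_tensor => [c s s'|c s s'|x' y'].
- by rewrite lead_linear q2r.
- rewrite lead_linear !q2r !lead_linear !scalerDr.
  by rewrite [LHS](AC (2*2*2) ((1*3*5)*(2*4*6))).
rewrite !lead_tensor !qs2_tensor !lead_tensor (qs_lcons op0 opC).
by rewrite !(linD (tensor_linear_l _)).
Qed.

(** Each deconcatenation is split by [deconcatenation_lcons] into an empty-left-factor part and a
    part with a leading letter. The product of the leading parts obeys [qs2_lead], and the mixed
    products are absorbed by [qs2_lead_l] and [qs2_lead_r]; induction is on the total length. *)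
Lemma deconcatenation_qs x y :
  deconcatenation (qs x y) = qs2 (deconcatenation x) (deconcatenation y).
Proof.
have dl := @deconcatenation_linear k A.
have d1 : deconcatenation (word [::]) = tensor (word [::]) (word [::]).
  by rewrite deconcatenation_word big_seq1.
have q1s s : qs2 (tensor (word [::]) (word [::])) s = s.
  move: s; apply: eq_on_tensor => [||x0 y0]; [exact: q2r|by []|].
  by rewrite qs2_tensor !qs1x.
have qs1 s : qs2 s (tensor (word [::]) (word [::])) = s.
  move: s; apply: eq_on_tensor => [||x0 y0]; [exact: q2l|by []|].
  by rewrite qs2_tensor !qsx1.
move: x; apply: eq_on_words => [c x x'|c x x'|u].
- by rewrite qsl dl.
- by rewrite dl q2l.
move: y; apply: eq_on_words => [c x x'|c x x'|v].
- by rewrite qsr dl.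
- by rewrite dl q2r.
have [n] := ubnP (size u + size v).
elim: n u v => // n IHn [|a u] v; first by rewrite qs1x d1 q1s.
case: v => [|b v]; first by rewrite qsx1 d1 qs1.
rewrite /= !(addSn, addnS) !ltnS => ltn.
have H1 := IHn u (b :: v); have H2 := IHn (a :: u) v; have H3 := IHn u v.
move: H1 H2 H3; rewrite /= !(addSn, addnS) ltn -!lcons_word.
move=> /(_ isT) H1 /(_ isT) H2 /(_ (ltnW ltn)) H3.
clear ltn IHn; move: (word u) (word v) H1 H2 H3 => {}u {}v H1 H2 H3.
rewrite (qs_lcons op0 opC) !(linD dl).
rewrite !deconcatenation_lcons H1 H2 H3 !deconcatenation_lcons.
rewrite !(linD (q2l _)) !(linD (q2r _)) !(linD (lead_linear _)).
rewrite qs2_lead qs2_lead_l qs2_lead_r qs2_tensor qs1x (qs_lcons op0 opC).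
rewrite !(linD (tensor_linear_r _)).
by rewrite [LHS](AC ((1*2)*(1*2)*2) ((1*4*7*5)*(2*(3*6*8)))).
Qed.

Lemma qs_bialgebra : is_bialgebra qs_hopf.
Proof.
split.
- split; [exact: qsl|exact: qsr|exact: qsA|exact: qs1x|exact: qsx1].
- split; first exact: deconcatenation_linear.
  + exact: nc_counit_linear.
  + exact: deconcatenation_coassoc.
  + exact: deconcatenation_counit_l.
  + exact: deconcatenation_counit_r.
- split=> [x y|]; first by have := deconcatenation_qs x y; rewrite /qs2 unlock.
  by rewrite /= deconcatenation_word big_seq1 tensorE.
- by split=> [x y|]; [exact: nc_counit_qs|exact: nc_counit_word].
Qed.

Lemma convolution_qs (f g : NC -> NC) w :
  tens_lift qs (tens_map f g (deconcatenation (word w)))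
  = convolution qs (fun u => f (word u)) (fun u => g (word u)) w.
Proof.
rewrite tens_map_deconcatenation (lin_sum (tens_lift_linear _)).
by apply: eq_bigr => p _; rewrite (tens_liftE qsl qsr).
Qed.

(** By linearity the antipode axioms may be tested on words, where they say that S is a two-sided
    convolution inverse of the inclusion of words. *)
Lemma qs_antipodeP (S : NC -> NC) :
  is_antipode qs_hopf S <->
  [/\ linear S,
      forall w, convolution qs (fun u => S (word u)) word w
                = convolution_unit (word [::]) w
    & forall w, convolution qs word (fun u => S (word u)) w
                = convolution_unit (word [::]) w].
Proof.
have unitE w : nc_counit (word w) *: word [::] = convolution_unit (word [::]) w.
  by rewrite nc_counit_word.
have dl := @deconcatenation_linear k A.
have lin (f g : NC -> NC) :
    linear (fun x => tens_lift qs (tens_map f g (deconcatenation x))).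
  exact: lin_comp dl (lin_comp (tens_map_linear _ _) (tens_lift_linear _)).
have linu : linear (fun x => nc_counit x *: word [::]).
  exact: lin_scale (@nc_counit_linear k A).
split=> [[Sl S1 S2]|[Sl S1 S2]]; split=> // x.
- by rewrite -unitE -(S1 (word x)) -(convolution_qs S id).
- by rewrite -unitE -(S2 (word x)) -(convolution_qs id S).
- move: x; apply: eq_on_words => [||w]; [exact: lin|exact: linu|].
  exact: etrans (convolution_qs S id w) (etrans (S1 w) (esym (unitE w))).
- move: x; apply: eq_on_words => [||w]; [exact: lin|exact: linu|].
  exact: etrans (convolution_qs id S w) (etrans (S2 w) (esym (unitE w))).
Qed.

Lemma qs_hopf_algebra : is_hopf_algebra qs_hopf.
Proof.
split; first exact: qs_bialgebra.
(* The inclusion of words sends the empty word to the unit, hence is invertible for convolution; the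
   antipode is the linear extension of its inverse. *)
pose g := conv_inv qs (word [::]) word.
exists (lin_ext (fun u : {fmonom A} => g u)); apply/qs_antipodeP.
have gE u : lin_ext (fun u : {fmonom A} => g u) (word u) = g u.
  exact: lin_extU.
split=> [|w|w]; first exact: lin_ext_linear.
- rewrite (eq_convolution _ _ gE (frefl _)).
  exact: (conv_inv_convolution qsl qsr (qsA op0 opC opA) (@qs1x _ _ _) (@qsx1 _ _ _)).
- rewrite (eq_convolution _ _ (frefl _) gE).
  apply: (convolution_inv qsr (@qs1x _ _ _) (@qsx1 _ _ _) (f := word)).
  by [].
Qed.

End QuasiShuffleHopf.

(** * Compatibility of exp with the coalgebra structure *)

Lemma big_compositions (M : nmodType) (F : seq nat -> M) n :
  \sum_(I <- compositions n.+1) F I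
  = \sum_(i < n.+1) \sum_(J <- compositions (n - i)) F (i.+1 :: J).
Proof.
elim: n F => [|n IHn] F; first by rewrite big_ord1 /= !big_seq1.
(* A first block of size 1 gives the term i = 0. The other compositions enlarge the first block of a
   nonempty composition of [n.+1], so the induction hypothesis is used for a shifted summand. *)
rewrite [compositions n.+2]/(_ ++ _) big_cat big_map big_ord_recl subn0.
congr (_ + _); rewrite big_map big_filter big_mkcond.
rewrite (IHn (fun I => if I != [::] then F ((head 0%N I).+1 :: behead I) else 0)).
by apply: eq_bigr => i _; rewrite lift0 subSS.
Qed.

Section ExpCoalgebra.
Variables (k : fieldType) (A : choiceType).
Variable op : option A -> option A -> option A.
Local Notation NC := {malg k[{fmonom A}]}.
Local Notation NC2 := {malg k[({fmonom A} * {fmonom A})%type]}.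
Local Notation word := (@Defs.word k A).
Local Notation letter := (@Defs.letter k A).
Local Notation bracket := (@bracket_seq A op).
Implicit Types (w u v : seq A) (a : A) (o p : option A) (x y z : NC).
Implicit Types (s t : NC2).

Definition inv_fact n : k := (n`!)%:R^-1.

Lemma inv_factE n : inv_fact n = (n`!)%:R^-1. Proof. by []. Qed.

Fact qx_key : unit. Proof. exact: tt. Qed.

Definition qx : NC -> NC := locked_with qx_key (qexp k op).

Lemma qxE : qx = qexp k op. Proof. by rewrite /qx unlock. Qed.

Lemma qx_linear : linear qx.
Proof. by rewrite qxE; exact: lin_ext_linear. Qed.

Lemma qx_nil : qx (word [::]) = word [::].
Proof.
rewrite qxE /qexp lin_ext_word big_seq1 big_nil invr1 scale1r.
by rewrite /composition_action big_nil word_nil.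
Qed.

Lemma composition_action_cons i J w :
  composition_action k op (i :: J) w
  = lcons (bracket (take i w)) (composition_action k op J (drop i w)).
Proof. by rewrite lconsE /composition_action big_cons. Qed.

(** The coefficient and the brackets are both multiplicative over blocks, so the first block splits
    off. It consists of [a] and [p.1], whence the successor in the factorial. *)
Lemma qx_cons a w :
  qx (word (a :: w))
  = \sum_(p <- splits w) inv_fact (size p.1).+1
      *: lcons (bracket (a :: p.1)) (qx (word p.2)).
Proof.
rewrite {1}qxE /qexp lin_ext_word big_compositions.
pose F u v := inv_fact (size u).+1 *: lcons (bracket (a :: u)) (qx (word v)).
rewrite -(big_take_drop F); apply: eq_bigr => i _.
have iw : (i <= size w)%N by rewrite -ltnS.
rewrite /F size_takel // qxE /qexp lin_ext_word (lin_sum (lcons_linear _)).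
rewrite scaler_sumr size_drop; apply: eq_bigr => J _.
rewrite composition_action_cons big_cons invfM -scalerA.
by rewrite (linZ (lcons_linear _)).
Qed.

(** The product p(u) x, with p(u) = [u] / |u|!. It vanishes for empty [u] because [bracket_seq] has
    the default value [None] there, so sums may run over all factorizations. *)
Definition prefix_term u x : NC := inv_fact (size u) *: lcons (bracket u) x.

Lemma prefix_term_nil x : prefix_term [::] x = 0.
Proof. by rewrite /prefix_term lcons_None scaler0. Qed.

Lemma qx_rec w :
  qx (word w) = (w == [::])%:R *: word [::]
                + \sum_(p <- splits w) prefix_term p.1 (qx (word p.2)).
Proof.
case: w => [|a w].
  by rewrite big_seq1 prefix_term_nil addr0 scale1r qx_nil.
rewrite (big_splits_cons (fun u v => prefix_term u (qx (word v)))).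
by rewrite prefix_term_nil scale0r !add0r qx_cons.
Qed.

Lemma nc_counit_qx x : nc_counit (qx x) = nc_counit x.
Proof.
have el := @nc_counit_linear k A.
move: x; apply: (@eq_on_words _ _ k^o) => [||w].
- exact: lin_comp qx_linear el.
- exact: el.
rewrite qx_rec (linD el) (linZ el) (lin_sum el) big1 => [|p _].
  by rewrite addr0 !nc_counit_word [_ *: _]mulr1.
by rewrite (linZ el) nc_counit_lcons scaler0.
Qed.

Lemma deconcatenation_prefix_term u x :
  deconcatenation (prefix_term u x)
  = tensor (word [::]) (prefix_term u x)
    + inv_fact (size u) *: lead (bracket u) (deconcatenation x).
Proof.
rewrite (linZ (@deconcatenation_linear k A)) deconcatenation_lcons scalerDr.
by rewrite (linZ (tensor_linear_r _)).
Qed.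

(** Applying the coproduct to [qx_rec] leaves a part with empty left factor and a part led by a
    block. Induction on the length turns the latter into a sum over triple factorizations, which
    coassociativity regroups into left factors of the form required by [qx_rec]. *)
Lemma deconcatenation_qx_word w :
  deconcatenation (qx (word w))
  = \sum_(p <- splits w) tensor (qx (word p.1)) (qx (word p.2)).
Proof.
have dl := @deconcatenation_linear k A.
have [n] := ubnP (size w); elim: n w => // n IHn w; rewrite ltnS => lewn.
have lead_term (p : seq A * seq A) : p \in splits w ->
    inv_fact (size p.1) *: lead (bracket p.1) (deconcatenation (qx (word p.2)))
    = \sum_(q <- splits p.2)
        tensor (prefix_term p.1 (qx (word q.1))) (qx (word q.2)).
  case: p => u v /splits_size /= szw; case: u szw => [_|a u szw].
    rewrite (_ : lead _ _ = 0); last first.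
      move: (deconcatenation _); apply: eq_on_tensor => [c s t||x y].
      - exact: lead_linear.
      - by move=> c s t; rewrite scaler0 addr0.
      by rewrite lead_tensor lcons_None (lin0 (tensor_linear_l _)).
    rewrite scaler0 big1 // => q _.
    by rewrite prefix_term_nil (lin0 (tensor_linear_l _)).
  rewrite IHn; last by rewrite (leq_trans _ lewn) // -szw /= addSn ltnS leq_addl.
  rewrite (lin_sum (lead_linear _)) scaler_sumr; apply: eq_bigr => q _.
  by rewrite lead_tensor (linZ (tensor_linear_l _)).
rewrite qx_rec (linD dl) (linZ dl) (lin_sum dl).
rewrite (eq_bigr _ (fun r _ => deconcatenation_prefix_term r.1 _)).
rewrite big_split /= addrA deconcatenation_word big_seq1.
(* The terms with empty left factor add up to 1 ⊗ exp(w), by [qx_rec] read backwards. *)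
rewrite -(linZ (tensor_linear_r _)) -(lin_sum (tensor_linear_r _)).
rewrite -(linD (tensor_linear_r _)) -qx_rec.
rewrite (eq_big_seq _ lead_term).
rewrite -(splits_coassoc
  (fun u v w => tensor (prefix_term u (qx (word v))) (qx (word w)))).
(* Spread over all factorizations by means of the counit, 1 ⊗ exp(w) supplies the counit term of
   [qx_rec] for each left factor. *)
rewrite -[X in X + _ = _](splits_counit_l (fun v => tensor (word [::]) (qx (word v)))).
rewrite -big_split; apply: eq_bigr => p _ /=.
rewrite -(linZ (tensor_linear_l _)) -(lin_sum (tensor_linear_l _)).
by rewrite -(linD (tensor_linear_l _)) -qx_rec.
Qed.

Lemma deconcatenation_qx x :
  deconcatenation (qx x) = tens_map qx qx (deconcatenation x).
Proof.
have dl := @deconcatenation_linear k A.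
move: x; apply: eq_on_words => [||w].
- exact: lin_comp qx_linear dl.
- exact: lin_comp dl (tens_map_linear _ _).
by rewrite deconcatenation_qx_word tens_map_deconcatenation tensorE.
Qed.

End ExpCoalgebra.

(** * Single-letter components and recovery of an element from its coproduct *)

Section Primitive.
Variables (k : fieldType) (A : choiceType).
Local Notation NC := {malg k[{fmonom A}]}.
Local Notation NC2 := {malg k[({fmonom A} * {fmonom A})%type]}.
Local Notation word := (@Defs.word k A).
Local Notation letter := (@Defs.letter k A).
Implicit Types (w u v : seq A) (a : A) (o : option A) (x y z : NC).

Fact letter_part_key : unit. Proof. exact: tt. Qed.

Definition letter_part : NC -> NC := locked_with letter_part_key
  (lin_ext (fun u : {fmonom A} => if size u == 1%N then word u else 0)).

Lemma letter_part_linear : linear letter_part.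
Proof. by rewrite /letter_part unlock; exact: lin_ext_linear. Qed.

Lemma letter_part_word u :
  letter_part (word u) = if size u == 1%N then word u else 0.
Proof. by rewrite /letter_part unlock lin_ext_word. Qed.

Lemma letter_part_lcons o x : letter_part (lcons o x) = nc_counit x *: letter o.
Proof.
case: o => [a|]; last by rewrite lcons_None (lin0 letter_part_linear) scaler0.
move: x; apply: eq_on_words => [||u].
- exact: lin_comp (lcons_linear _) letter_part_linear.
- exact: lin_scale (@nc_counit_linear k A).
rewrite lcons_word letter_part_word nc_counit_word.
by case: u => [|b u]; rewrite ?scale1r ?scale0r.
Qed.

(** The map sending z' ⊗ z'' to pi(z') z'', where pi is [letter_part]. *)
Definition join : NC2 -> NC :=
  lin_ext (fun p : ({fmonom A} * {fmonom A})%type =>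
             if size p.1 == 1%N then word (p.1 ++ p.2) else 0).

Lemma join_linear : linear join. Proof. exact: lin_ext_linear. Qed.

Lemma join_words u v :
  join (tensor (word u) (word v)) = if size u == 1%N then word (u ++ v) else 0.
Proof. by rewrite tensorE tensU /join lin_extU. Qed.

Lemma join_letter_part x y : join (tensor x y) = join (tensor (letter_part x) y).
Proof.
move: x; apply: eq_on_words => [||u].
- exact: lin_comp (tensor_linear_l _) join_linear.
- exact: lin_comp letter_part_linear (lin_comp (tensor_linear_l _) join_linear).
move: y; apply: eq_on_words => [||v].
- exact: lin_comp (tensor_linear_r _) join_linear.
- exact: lin_comp (tensor_linear_r _) join_linear.
rewrite letter_part_word; case: ifP => su; first exact: erefl.
by rewrite join_words su (lin0 (tensor_linear_l _)) (lin0 join_linear).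
Qed.

(** A nonempty word has exactly one factorization whose left factor is a single letter, and [join]
    reassembles it. *)
Lemma join_deconcatenation x :
  x = nc_counit x *: word [::] + join (deconcatenation x).
Proof.
move: x; apply: eq_on_words => [||w].
- by [].
- apply: lin_add; first exact: lin_scale (@nc_counit_linear k A).
  exact: lin_comp (@deconcatenation_linear k A) join_linear.
rewrite deconcatenation_word (lin_sum join_linear) nc_counit_word.
have joinE (r : seq A * seq A) : join (tensor (word r.1) (word r.2))
    = if size r.1 == 1%N then word (r.1 ++ r.2) else 0 := join_words r.1 r.2.
rewrite (eq_bigr _ (fun r _ => joinE r)).
case: w => [|a w]; first by rewrite big_seq1 scale1r addr0.
rewrite (big_splits_cons (fun u v => if size u == 1%N then word (u ++ v) else 0)).
rewrite scale0r !add0r -[LHS](splits_counit_l (fun v => word (a :: v))).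
by apply: eq_bigr => -[[|b u] v] _; rewrite ?scale1r ?scale0r.
Qed.

Lemma eq_by_join x y :
  nc_counit x = nc_counit y ->
  join (deconcatenation x) = join (deconcatenation y) -> x = y.
Proof.
by move=> ex jx; rewrite [LHS]join_deconcatenation ex jx -join_deconcatenation.
Qed.

Variable op : option A -> option A -> option A.
Hypothesis op0 : forall o, op o None = None.
Hypothesis opC : forall o p, op o p = op p o.

Fact bracket_part_key : unit. Proof. exact: tt. Qed.

(** A bilinear extension of the bracket; it is evaluated on combinations of single letters, where
    [bracket_seq] returns the letter itself. *)
Definition bracket_part : NC -> NC -> NC := locked_with bracket_part_key
  (fun x y => lin_ext (fun u : {fmonom A} => lin_ext (fun v : {fmonom A} =>
     letter (op (bracket_seq op u) (bracket_seq op v))) y) x).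

Lemma bracket_part_linear_l y : linear (bracket_part^~ y).
Proof. by rewrite /bracket_part unlock => c x x'; rewrite lin_ext_linear. Qed.

Lemma bracket_part_linear_r x : linear (bracket_part x).
Proof.
rewrite /bracket_part unlock => c y y'.
rewrite {1 3 5}/lin_ext scaler_sumr -big_split.
apply: eq_bigr => u _ /=.
by rewrite lin_ext_linear scalerDr !scalerA mulrC.
Qed.

Lemma bracket_part_letter o p :
  bracket_part (letter o) (letter p) = letter (op o p).
Proof.
case: o => [a|]; last by rewrite opC op0 (lin0 (bracket_part_linear_l _)).
case: p => [b|]; last by rewrite op0 (lin0 (bracket_part_linear_r _)).
by rewrite /bracket_part unlock !lin_ext_word.
Qed.

(** If one word is empty, only a counit term remains. For two nonempty words, the first two terms of
    [qs_lcons] have a nonempty factor behind their leading letter and contribute nothing; the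
    bracket term contributes exactly when both tails are empty. *)
Lemma letter_part_qs x y :
  letter_part (qs op x y)
  = nc_counit x *: letter_part y + nc_counit y *: letter_part x
    + bracket_part (letter_part x) (letter_part y).
Proof.
have el := @nc_counit_linear k A.
have pl := letter_part_linear.
have bl := bracket_part_linear_l; have br := bracket_part_linear_r.
have p1 : letter_part (word [::]) = 0 by rewrite letter_part_word.
have e1 : nc_counit (word [::]) = 1 :> k by rewrite nc_counit_word.
move: x; apply: eq_on_words => [||u].
- exact: lin_comp (qs_linear_l op y) pl.
- apply: lin_add; last exact: lin_comp pl (bl _).
  apply: lin_add; first exact: lin_scale el.
  by move=> c x x'; rewrite pl scalerDr !scalerA mulrC.
move: y; apply: eq_on_words => [||v].
- exact: lin_comp (qs_linear_r op _) pl.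
- apply: lin_add; last exact: lin_comp pl (br _).
  apply: lin_add; last exact: lin_scale el.
  by move=> c x x'; rewrite pl scalerDr !scalerA mulrC.
case: u => [|a u].
  by rewrite qs1x p1 e1 (lin0 (bl _)) scaler0 scale1r !addr0.
case: v => [|b v].
  by rewrite qsx1 p1 e1 (lin0 (br _)) scaler0 scale1r addr0 add0r.
rewrite -!lcons_word (qs_lcons op0 opC) !(linD pl) !letter_part_lcons.
have combine (M : lmodType k) (c d : k) (X Y Z : M) :
    0 *: X + 0 *: Y + (c * d) *: Z = 0 *: (d *: Y) + 0 *: (c *: X) + d *: (c *: Z).
  by rewrite !scale0r scalerA mulrC.
rewrite (linZ (br _)) (linZ (bl _)) bracket_part_letter.
rewrite (nc_counit_lcons (Some a)) (nc_counit_lcons (Some b)).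
rewrite !(nc_counit_qs op0 opC).
rewrite (nc_counit_lcons (Some a)) (nc_counit_lcons (Some b)) mulr0 mul0r.
exact: combine.
Qed.

End Primitive.

(** * Multiplicativity of exp on single-letter components *)

Definition no_bracket (A : Type) (_ _ : option A) : option A := None.

Section ExpMultiplicative.
Variables (k : fieldType) (A : choiceType).
Variable op : option A -> option A -> option A.
Hypothesis op0 : forall o, op o None = None.
Hypothesis opC : forall o p, op o p = op p o.
Hypothesis opA : forall o p q, op (op o p) q = op o (op p q).
Hypothesis fact_neq0 : forall n, (n`!)%:R != 0 :> k.
Local Notation NC := {malg k[{fmonom A}]}.
Local Notation NC2 := {malg k[({fmonom A} * {fmonom A})%type]}.
Local Notation word := (@Defs.word k A).
Local Notation letter := (@Defs.letter k A).
Local Notation bracket := (@bracket_seq A op).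
Local Notation sh := (@qs k A (@no_bracket A)).
Local Notation qx := (@qx k A op).
Local Notation inv_fact := (@inv_fact k).
Implicit Types (w u v : seq A) (a b : A) (o : option A) (x y z : NC).

Let nb0 o : no_bracket o (@None A) = None. Proof. by []. Qed.
Let nbC o p : no_bracket o p = @no_bracket A p o. Proof. by []. Qed.

(** An iterated bracket with an arbitrary innermost entry [o], which serves as accumulator and gives
    the empty word a meaningful value. *)
Definition fold_bracket o w := foldr (fun a r => op (Some a) r) o w.

Lemma fold_bracket_op o p w : fold_bracket (op o p) w = op o (fold_bracket p w).
Proof.
elim: w => //= a w ->.
by rewrite -!opA (opC (Some a)).
Qed.

Lemma fold_bracket_mid o u b v :
  fold_bracket o (u ++ b :: v) = op (Some b) (fold_bracket o (u ++ v)).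
Proof. by rewrite /fold_bracket !foldr_cat /= [LHS]fold_bracket_op. Qed.

Lemma bracket_cons a w : bracket (a :: w) = fold_bracket (Some a) w.
Proof.
elim: w a => // b w IHw a.
rewrite -[LHS]/(op (Some a) (bracket (b :: w))) IHw.
rewrite -[RHS]/(op (Some b) (fold_bracket (Some a) w)) -!fold_bracket_op.
by rewrite opC.
Qed.

(** By associativity and commutativity the innermost letter of the second fold becomes one more
    letter of the first. *)
Lemma bracket_cat a u b v :
  op (bracket (a :: u)) (bracket (b :: v)) = fold_bracket (Some a) (u ++ b :: v).
Proof.
rewrite !bracket_cons fold_bracket_mid -[RHS]fold_bracket_op.
rewrite (opC (Some b) (Some a)) [LHS]opC -[LHS]fold_bracket_op.
rewrite (opC _ (Some a)) -[in LHS]fold_bracket_op.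
by rewrite [RHS]/fold_bracket foldr_cat.
Qed.

(* The accumulators m and o record the letters already stripped from the
   front of a word, so that stripping one more is divided_bracket_lcons. *)
Definition divided_bracket m o : NC -> NC :=
  lin_ext (fun u : {fmonom A} => inv_fact (size u + m) *: letter (fold_bracket o u)).

Lemma divided_bracket_linear m o : linear (divided_bracket m o).
Proof. exact: lin_ext_linear. Qed.

Lemma divided_bracket_word m o u : divided_bracket m o (word u)
  = inv_fact (size u + m) *: letter (fold_bracket o u).
Proof. exact: lin_ext_word. Qed.

Lemma divided_bracket_lcons m o a x :
  divided_bracket m o (lcons (Some a) x)
  = divided_bracket m.+1 (op (Some a) o) x.
Proof.
move: x; apply: eq_on_words => [||u].
- exact: lin_comp (lcons_linear _) (divided_bracket_linear _ _).
- exact: divided_bracket_linear.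
by rewrite lcons_word !divided_bracket_word fold_bracket_op addnS.
Qed.

Lemma shuffle_cons a u b v :
  sh (word (a :: u)) (word (b :: v))
  = lcons (Some a) (sh (word u) (word (b :: v)))
    + lcons (Some b) (sh (word (a :: u)) (word v)).
Proof.
have := qs_lcons nb0 nbC (Some a) (Some b) (word u) (word v).
by rewrite !lcons_word lcons_None addr0.
Qed.

(** The two summands count the shuffles of words of lengths m+1 and n+1 by the word that provides
    the first letter. *)
Lemma pascal (M : lmodType k) (c : k) (X : M) m n :
  ('C(m + n.+1, m))%:R *: (c *: X) + ('C(m.+1 + n, m.+1))%:R *: (c *: X)
  = ('C(m.+1 + n.+1, m.+1))%:R *: (c *: X).
Proof.
rewrite -scalerDl -natrD; congr (_%:R *: _).
by rewrite [(m.+1 + n.+1)%N]addSn binS addnC addnS addSn.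
Qed.

(** All shuffles of [u] and [v] have the same length and the same bracket, so it suffices to count
    them; separating them by first letter gives Pascal's rule, with the stripped letter moved into
    [m] and [o]. *)
Lemma divided_bracket_shuffle m o u v :
  divided_bracket m o (sh (word u) (word v))
  = ('C(size u + size v, size u))%:R
      *: (inv_fact (size u + size v + m) *: letter (fold_bracket o (u ++ v))).
Proof.
have [n] := ubnP (size u + size v).
elim: n m o u v => // n IHn m o [|a u] v.
  by rewrite qs1x divided_bracket_word bin0 scale1r.
case: v => [|b v].
  by rewrite qsx1 divided_bracket_word cats0 addn0 binn scale1r.
move=> lt; have {lt} ltn : ((size u + size v).+1 < n)%N.
  by move: lt; rewrite /= !(addSn, addnS) !ltnS.
rewrite shuffle_cons (linD (divided_bracket_linear _ _)) !divided_bracket_lcons.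
rewrite IHn; last by rewrite /= addnS.
rewrite IHn; last by rewrite /= addSn.
rewrite [size (a :: u)]/= [size (b :: v)]/=.
have -> : ((size u).+1 + (size v).+1 + m = size u + (size v).+1 + m.+1)%N.
  by rewrite !(addSn, addnS).
have -> : ((size u).+1 + size v + m.+1 = size u + (size v).+1 + m.+1)%N.
  by rewrite !(addSn, addnS).
have -> : fold_bracket (op (Some a) o) (u ++ b :: v)
          = fold_bracket o ((a :: u) ++ b :: v) by exact: fold_bracket_op.
have -> : fold_bracket (op (Some b) o) ((a :: u) ++ v)
          = fold_bracket o ((a :: u) ++ b :: v).
  by rewrite fold_bracket_op [RHS]fold_bracket_mid.
exact: pascal.
Qed.

(** The counit kills every term of [qx_rec] except the one whose first block is the whole word. *)
Lemma letter_part_qx u :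
  letter_part (qx (word u)) = inv_fact (size u) *: letter (bracket u).
Proof.
have pl := @letter_part_linear k A.
rewrite qx_rec (linD pl) (linZ pl) letter_part_word scaler0 add0r (lin_sum pl).
rewrite -[RHS](splits_counit_r (fun u => inv_fact (size u) *: letter (bracket u))).
apply: eq_bigr => r _; rewrite (linZ pl) letter_part_lcons nc_counit_qx.
by rewrite nc_counit_word !scalerA mulrC.
Qed.

Lemma letter_part_qx_lcons a x :
  letter_part (qx (lcons (Some a) x)) = divided_bracket 1 (Some a) x.
Proof.
move: x; apply: eq_on_words => [||u].
- exact: lin_comp (lin_comp (lcons_linear _) (qx_linear _)) (@letter_part_linear k A).
- exact: divided_bracket_linear.
by rewrite lcons_word letter_part_qx divided_bracket_word bracket_cons addn1.
Qed.

Lemma inv_fact_bin m n :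
  ('C(m + n, m))%:R * inv_fact (m + n) = inv_fact m * inv_fact n.
Proof.
rewrite !inv_factE -invfM -natrM.
have := bin_fact (leq_addr n m); rewrite addKn => <-.
rewrite natrM invfM mulrA mulfV ?mul1r //.
have := fact_neq0 (m + n); rewrite -(bin_fact (leq_addr n m)) natrM.
by rewrite mulf_eq0 negb_or => /andP[].
Qed.

Lemma letter_part_qx_shuffle u v :
  letter_part (qx (sh (word u) (word v)))
  = letter_part (qs op (qx (word u)) (qx (word v))).
Proof.
case: u => [|a u]; first by rewrite qx_nil !qs1x.
case: v => [|b v]; first by rewrite qx_nil !qsx1.
(* Splitting the shuffles by first letter provides the innermost entry that [letter_part_qx_lcons]
   requires; [pascal] recombines the two counts below. On the right, both counits vanish and only
   the bracket term is left. *)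
rewrite shuffle_cons (linD (qx_linear _)) (linD (@letter_part_linear k A)).
rewrite !letter_part_qx_lcons !divided_bracket_shuffle.
rewrite (letter_part_qs op0 opC) !nc_counit_qx !nc_counit_word !scale0r !add0r.
rewrite !letter_part_qx (linZ (bracket_part_linear_l _ _)).
rewrite (linZ (bracket_part_linear_r _ _)) (bracket_part_letter _ op0 opC).
rewrite bracket_cat [RHS]scalerA.
rewrite -(inv_fact_bin (size (a :: u)) (size (b :: v))) -scalerA -pascal.
have -> : fold_bracket (Some b) ((a :: u) ++ v)
          = fold_bracket (Some a) (u ++ b :: v).
  by rewrite fold_bracket_mid /= -!fold_bracket_op opC.
by rewrite /= !(addSn, addnS) addn0.
Qed.

End ExpMultiplicative.

(** * Exp as a morphism of Hopf algebras *)

Section ExpMorphism.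
Variables (k : fieldType) (A : choiceType).
Variable op : option A -> option A -> option A.
Hypothesis op0 : forall o, op o None = None.
Hypothesis opC : forall o p, op o p = op p o.
Hypothesis opA : forall o p q, op (op o p) q = op o (op p q).
Hypothesis fact_neq0 : forall n, (n`!)%:R != 0 :> k.
Local Notation NC := {malg k[{fmonom A}]}.
Local Notation NC2 := {malg k[({fmonom A} * {fmonom A})%type]}.
Local Notation word := (@Defs.word k A).
Local Notation sh := (@qs k A (@no_bracket A)).
Local Notation qs := (@qs k A op).
Local Notation qx := (@qx k A op).
Implicit Types (w u v : seq A) (a b : A) (x y z : NC).

Lemma tens_map_tensor (f g : NC -> NC) x y :
  linear f -> linear g -> tens_map f g (tensor x y) = tensor (f x) (g y).
Proof. by move=> lf lg; rewrite tensorE tens_mapE. Qed.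

(** By [eq_by_join] it suffices to compare counits and joins of coproducts. In the latter the left
    tensor factors matter only through their letter parts, which agree by [letter_part_qx_shuffle],
    and the right ones are products of suffixes. *)
Lemma qx_shuffle x y : qx (sh x y) = qs (qx x) (qx y).
Proof.
have nb0 o : no_bracket o (@None A) = None by [].
have nbC o p : no_bracket o p = @no_bracket A p o by [].
have ql := @qx_linear k A op.
move: x; apply: eq_on_words => [||u].
- exact: lin_comp (qs_linear_l _ y) ql.
- exact: lin_comp ql (qs_linear_l _ _).
move: y; apply: eq_on_words => [||v].
- exact: lin_comp (qs_linear_r _ _) ql.
- exact: lin_comp ql (qs_linear_r _ _).
have [n] := ubnP (size u + size v).
elim: n u v => // n IHn u v; rewrite ltnS => leuv; apply: eq_by_join.
  by rewrite nc_counit_qx (nc_counit_qs nb0 nbC) (nc_counit_qs op0 opC) !nc_counit_qx.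
rewrite deconcatenation_qx (deconcatenation_qs nb0 nbC).
rewrite (deconcatenation_qs op0 opC) !deconcatenation_qx_word.
rewrite !deconcatenation_word.
rewrite (qs2_big op (fun w => qx (word w)) (fun w => qx (word w))).
rewrite (qs2_big (@no_bracket A) word word).
rewrite (lin_sum (tens_map_linear _ _)) !(lin_sum (@join_linear k A)).
apply: eq_big_seq => -[u1 u2] /splits_size /= szu.
rewrite (lin_sum (tens_map_linear _ _)) !(lin_sum (@join_linear k A)).
apply: eq_big_seq => -[v1 v2] /splits_size /= szv.
rewrite (tens_map_tensor _ _ ql ql) join_letter_part [RHS]join_letter_part.
rewrite (letter_part_qx_shuffle op0 opC opA fact_neq0).
(* If a prefix is nonempty, the suffixes are shorter in total and induction applies. If both are
   empty, the left factor is the empty word, whose letter part is zero. *)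
case: (posnP (size u1 + size v1)) => [/eqP|lt0]; last first.
  by rewrite IHn //; move: leuv; rewrite -szu -szv addnACA; apply: leq_trans;
    rewrite -{1}[(size u2 + _)%N]add0n ltn_add2r.
rewrite addn_eq0 !size_eq0 => /andP[/eqP-> /eqP->].
rewrite !qx_nil qs1x letter_part_word /=.
by rewrite !(lin0 (tensor_linear_l _)).
Qed.

(** Both sides are convolution inverses of exp on words: exp after [S] on the left because exp is
    multiplicative, [S'] after exp on the right because exp is comultiplicative. Uniqueness of
    inverses identifies them. *)
Lemma qx_antipode (S S' : NC -> NC) :
  is_antipode (qs_hopf k (@no_bracket A)) S -> is_antipode (qs_hopf k op) S' ->
  forall x, qx (S x) = S' (qx x).
Proof.
move=> /qs_antipodeP[Sl S1 _] [Sl' _ S2].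
have S2' x : tens_lift qs (tens_map id S' (deconcatenation x))
             = nc_counit x *: word [::] := S2 x.
have ql := @qx_linear k A op.
apply: eq_on_words => [||w]; [exact: lin_comp Sl ql|exact: lin_comp ql Sl'|].
apply: (convolution_inv_uniq (@qs_linear_l k A op) (@qs_linear_r k A op)
  (qsA op0 opC opA) (@qs1x k A op) (@qsx1 k A op)
  (g := fun u => qx (S (word u))) (f := fun u => qx (word u))
  (h := fun u => S' (qx (word u)))) => {}w.
  transitivity (qx (convolution_unit (word [::]) w)); last first.
    by rewrite /convolution_unit (linZ ql) qx_nil.
  by rewrite -S1 (lin_sum ql); apply: eq_bigr => p _; rewrite qx_shuffle.
transitivity (nc_counit (qx (word w)) *: word [::]); last first.
  by rewrite nc_counit_qx nc_counit_word.
rewrite -[RHS]S2'.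
rewrite deconcatenation_qx_word (lin_sum (tens_map_linear _ _)).
rewrite (lin_sum (tens_lift_linear _)); apply: eq_bigr => p _.
rewrite tens_map_tensor // tensorE.
by rewrite (tens_liftE (@qs_linear_l k A op) (@qs_linear_r k A op)).
Qed.

Lemma qx_hopf_morphism :
  is_hopf_morphism (qs_hopf k (@no_bracket A)) (qs_hopf k op) qx.
Proof.
split; first exact: qx_linear.
- by split; [exact: qx_shuffle|exact: qx_nil].
- exact: deconcatenation_qx.
- exact: nc_counit_qx.
- exact: qx_antipode.
Qed.

End ExpMorphism.

(** * Bijectivity of exp by the length filtration *)

Section ExpBijective.
Variables (k : fieldType) (A : choiceType).
Variable op : option A -> option A -> option A.
Local Notation NC := {malg k[{fmonom A}]}.
Local Notation word := (@Defs.word k A).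
Local Notation qx := (@qx k A op).
Implicit Types (w u v : seq A) (a b : A) (x y z : NC) (n m : nat).

Definition shorter n x := forall u : {fmonom A}, (n <= size u)%N -> x@_u = 0.

Lemma shorter0 n : shorter n 0.
Proof. by move=> u _; rewrite mcoeff0. Qed.

Lemma shorterD n x y : shorter n x -> shorter n y -> shorter n (x + y).
Proof. by move=> sx sy u nu; rewrite mcoeffD sx // sy // addr0. Qed.

Lemma shorterZ n c x : shorter n x -> shorter n (c *: x).
Proof. by move=> sx u nu; rewrite mcoeffZ sx // mulr0. Qed.

Lemma shorterN n x : shorter n x -> shorter n (- x).
Proof. by move=> sx u nu; rewrite mcoeffN sx // oppr0. Qed.

Lemma shorter_sum n (I : eqType) (r : seq I) (P : pred I) (F : I -> NC) :
  (forall i, i \in r -> P i -> shorter n (F i)) ->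
  shorter n (\sum_(i <- r | P i) F i).
Proof.
move=> sF; rewrite big_seq_cond; apply: (big_ind (shorter n)).
- exact: shorter0.
- exact: shorterD.
- by move=> i /andP[]; exact: sF.
Qed.

Lemma shorter_leq m n x : (m <= n)%N -> shorter m x -> shorter n x.
Proof. by move=> mn sx u nu; apply: sx; exact: leq_trans nu. Qed.

Lemma shorter_word n w : (size w < n)%N -> shorter n (word w).
Proof.
move=> wn u nu; rewrite /Defs.word mcoeffU; case: eqP => // wu.
by move: nu; rewrite -wu leqNgt wn.
Qed.

Lemma shorter_0 x : shorter 0 x -> x = 0.
Proof. by move=> sx; apply/malgP => u; rewrite sx // mcoeff0. Qed.

Lemma malg_words x : x = \sum_(u <- msupp x) x@_u *: word u.
Proof.
rewrite {1}[x]monalgE; apply: eq_bigr => u _.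
by rewrite malgU_scale word_fmonom.
Qed.

Lemma shorter_linear n m (F : NC -> NC) : linear F ->
  (forall w, (size w < n)%N -> shorter m (F (word w))) ->
  forall x, shorter n x -> shorter m (F x).
Proof.
move=> lF Fw x sx; rewrite [x]malg_words (lin_sum lF).
apply: shorter_sum => u ux _; rewrite (linZ lF); apply: shorterZ; apply: Fw.
by rewrite ltnNge; apply: contraL ux => /sx xu; rewrite -mcoeff_eq0 xu.
Qed.

Lemma shorter_exists x : exists n, shorter n x.
Proof.
exists (\max_(u <- msupp x) (size u).+1)%N => u le_u.
apply: mcoeff_outdom; apply: contraL le_u => ux.
by rewrite -ltnNge; apply: (@leq_bigmax_seq _ _ _ (fun u : {fmonom A} => (size u).+1)).
Qed.

Lemma shorter_lcons n o x : shorter n x -> shorter n.+1 (lcons o x).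
Proof.
apply: shorter_linear => [|w wn]; first exact: lcons_linear.
case: o => [a|]; last by rewrite lcons_None; exact: shorter0.
by rewrite lcons_word; exact: shorter_word.
Qed.

Lemma shorter_qx w : shorter (size w).+1 (qx (word w)).
Proof.
have [n] := ubnP (size w); elim: n w => // n IHn [|a w] len.
  by rewrite qx_nil; exact: shorter_word.
rewrite qx_cons; apply: shorter_sum => -[u v] /splits_size /= szw _.
apply: shorterZ; apply: shorter_lcons.
apply: (@shorter_leq (size v).+1); first by rewrite ltnS -szw leq_addl.
by apply: IHn; rewrite -ltnS (leq_trans _ len) //= !ltnS -szw leq_addl.
Qed.

(** A first block of one letter has coefficient 1 and leaves a(w - exp(w)), handled by induction; a
    longer first block merges at least two letters into one and so shortens the word. *)
Lemma shorter_sub_qx w : shorter (size w) (word w - qx (word w)).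
Proof.
elim: w => [|a w IHw]; first by rewrite qx_nil subrr; exact: shorter0.
rewrite qx_cons (big_splits_first (fun u v => inv_fact k (size u).+1
  *: lcons (bracket_seq op (a :: u)) (qx (word v)))).
have -> : inv_fact k (size (@nil A)).+1 = 1.
  by rewrite inv_factE factS fact0 muln1 invr1.
rewrite scale1r -lcons_word opprD addrA.
rewrite -(linN (lcons_linear _)) -(linD (lcons_linear _)).
apply: shorterD; first exact: shorter_lcons.
apply: shorterN; apply: shorter_sum => -[[|b u] v] //= /splits_size /= szw _.
apply: shorterZ; apply: shorter_lcons.
apply: (shorter_leq _ (@shorter_qx v)); rewrite -szw addSn ltnS; exact: leq_addl.
Qed.

Lemma shorter_sub_qx_linear n x : shorter n.+1 x -> shorter n (x - qx x).
Proof.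
apply: (@shorter_linear n.+1 n (fun x => x - qx x)) => [|w wn].
  apply: lin_add; first exact: lin_id.
  by apply: lin_opp; exact: qx_linear.
by apply: (shorter_leq _ (@shorter_sub_qx w)); rewrite -ltnS.
Qed.

Lemma qx_injective : injective qx.
Proof.
have ql := @qx_linear k A op.
(* If exp(x) = 0 then x = x - exp(x), so the length bound can be lowered until it reaches 0. *)
have ker n x : shorter n x -> qx x = 0 -> x = 0.
  elim: n => [|n IHn] sx qx0; first exact: shorter_0.
  by apply: IHn => //; have := shorter_sub_qx_linear sx; rewrite qx0 subr0.
move=> x y xy; apply/eqP; rewrite -subr_eq0; apply/eqP.
have [n sxy] := shorter_exists (x - y).
by apply: ker sxy _; rewrite (linD ql) (linN ql) xy subrr.
Qed.

Lemma qx_surjective y : exists x, qx x = y.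
Proof.
have ql := @qx_linear k A op.
have [n sy] := shorter_exists y.
elim: n y sy => [|n IHn] y sy.
  by exists 0; rewrite (lin0 ql) (shorter_0 sy).
have [x qxx] := IHn _ (shorter_sub_qx_linear sy).
(* As y - exp(y) satisfies a smaller length bound it equals some exp(x), whence y = exp(y + x). *)
by exists (y + x); rewrite (linD ql) qxx addrC subrK.
Qed.

Lemma qx_bijective : bijective qx.
Proof.
have [g gK] := choice qx_surjective.
by exists g => // x; apply: qx_injective; rewrite gK.
Qed.

End ExpBijective.

(** * The shuffle product as the quasi-shuffle product of the zero bracket, and the isomorphism *)

Lemma shuffle_word_no_bracket (k : fieldType) (A : choiceType) (u v : seq A) :
  shuffle_word k u v = quasi_shuffle_word k (@no_bracket A) u v.
Proof.
elim: u v => [//|a u IHu]; elim=> [//|b v IHv].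
have shE : shuffle_word k (a :: u) (b :: v)
    = lcons (Some a) (shuffle_word k u (b :: v))
      + lcons (Some b) (shuffle_word k (a :: u) v) by rewrite !lconsE.
have qsE : quasi_shuffle_word k (@no_bracket A) (a :: u) (b :: v)
    = lcons (Some a) (quasi_shuffle_word k (@no_bracket A) u (b :: v))
      + lcons (Some b) (quasi_shuffle_word k (@no_bracket A) (a :: u) v)
      + lcons None (quasi_shuffle_word k (@no_bracket A) u v) by rewrite !lconsE.
apply: (etrans shE); apply: (etrans _ (esym qsE)); rewrite lcons_None addr0.
exact: (congr2 (fun x y => lcons (Some a) x + lcons (Some b) y)
          (IHu (b :: v)) IHv).
Qed.

Lemma shuffleE (k : fieldType) (A : choiceType) :
  @shuffle k A = qs (@no_bracket A).
Proof.
have wordE : @shuffle_word k A = quasi_shuffle_word k (@no_bracket A).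
  by apply: funext => u; apply: funext => v; exact: shuffle_word_no_bracket.
by rewrite qsE /shuffle /quasi_shuffle wordE.
Qed.

Lemma shuffle_hopfE (k : fieldType) (A : choiceType) :
  shuffle_hopf k A = qs_hopf k (@no_bracket A).
Proof. by rewrite /shuffle_hopf shuffleE. Qed.

Theorem theorem3p3 (R : realType) (k : fieldType)
    (iota : {rmorphism k -> R[i]})
    (A : choiceType) (deg : A -> nat)
    (deg_gt0 : forall a : A, (0 < deg a)%N)
    (deg_finite : forall n : nat, finite_set [set a : A | deg a = n]%classic)
    (op : option A -> option A -> option A)
    (S0 : forall a : option A, op a None = None)
    (S1 : forall a b : option A, op a b = op b a)
    (S2 : forall a b c : option A, op (op a b) c = op a (op b c))
    (S3 : forall a b : A, op (Some a) (Some b) = None \/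
       exists c : A, op (Some a) (Some b) = Some c /\
                     deg c = (deg a + deg b)%N) :
  is_hopf_isomorphism (shuffle_hopf k A) (quasi_shuffle_hopf k op)
    (qexp k op).
Proof.
(* The embedding [iota] into the complex numbers forces characteristic zero, so factorials are
   invertible in [k]. *)
have fact_neq0 n : (n`!)%:R != 0 :> k.
  by rewrite -(fmorph_eq0 iota) rmorph_nat Num.Theory.pnatr_eq0 -lt0n fact_gt0.
rewrite shuffle_hopfE -qs_hopfE -qxE; split.
- exact: qs_hopf_algebra.
- exact: qs_hopf_algebra.
- exact: qx_hopf_morphism.
- exact: qx_bijective.
Qed.
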